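(* Let $S\in\mathbb{S}^d_m$, $Y\in\mathcal{L}_2(\mathbb{R}^d)$, $\nu:=\mathrm{Law}(Y)$. Let $G\in\mathcal{M}(S)$ be an optimal set for the dual problem and assume $\nu(\Sigma(P_G))=0$, i.e. $P_G(Y)$ is a.s. single-valued. Then $X:=P_G(Y)\mathbf{1}_{\{Y\notin\Sigma(P_G)\}}$ is the unique optimal map and $\mathrm{Law}(X,Y)$ is the unique optimal plan.
   Context: $\mathbb{S}^d_m$: symmetric invertible $d\times d$ real matrices with exactly $m$ positive eigenvalues; $S(x,y):=\langle x,Sy\rangle$. $G\subset\mathbb{R}^d$ is $S$-monotone if $S(x-y,x-y)\ge0$ for $x,y\in G$; maximal if not a strict subset of another $S$-monotone set; $\mathcal{M}(S)$ is the family of maximal $S$-monotone sets. $\psi_G(y):=\sup_{x\in G}(S(x,y)-\frac12S(x,x))$, $P_G(y):=\operatorname{argmax}_{x\in G}(S(x,y)-\frac12S(x,x))$ (its unique element is meant where it is a singleton). $\Sigma(P_G):=\{y:P_G(y)\ne\emptyset\text{ and is not a single point}\}$. $\mathcal{X}(Y):=\{X\in\mathcal{L}_2(\mathbb{R}^d):X\ Y\text{-measurable},\ \mathbb{E}[Y|X]=X\}$; an optimal map maximizes $\frac12\mathbb{E}[S(X,Y)]$ over $\mathcal{X}(Y)$. $\Gamma(\nu)$: Borel probability measures on $\mathbb{R}^d\times\mathbb{R}^d$ (coordinates $(x,y)$) with finite second moments, second marginal $\nu$, and conditional expectation of $y$ given $x$ equal to $x$; an optimal plan maximizes $\frac12\int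 S(x,y)d\gamma$ over $\Gamma(\nu)$. An optimal set of the dual problem minimizes $\int\psi_H\,d\nu$ over $H\in\mathcal{M}(S)$. Relations between random variables hold a.s. *)

(* Defs.v *)
From HB Require Import structures.
From mathcomp Require Import all_boot all_order all_algebra.
From mathcomp Require Import all_classical all_reals all_analysis.
Set Implicit Arguments. Unset Strict Implicit. Unset Printing Implicit Defensive.
Import Order.TTheory GRing.Theory Num.Theory.
Import numFieldNormedType.Exports.
Local Open Scope classical_set_scope.
Local Open Scope ring_scope.

Section Defs.
Variables (R : realType) (d : nat).

Definition Rd : measurableType _ := g_sigma_algebraType (@open 'rV[R]_d).

Definition Sform (S : 'M[R]_d) (x y : 'rV[R]_d) : R := (x *m S *m y^T) 0 0.

Definition in_Sdm (m : nat) (S : 'M[R]_d) : Prop :=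
  [/\ S^T = S, S \in unitmx &
      exists lam : 'I_d -> R,
        char_poly S = \prod_(i < d) ('X - (lam i)%:P) /\
        #|[pred i : 'I_d | 0 < lam i]| = m].

Definition S_monotone (S : 'M[R]_d) (G : set 'rV[R]_d) : Prop :=
  forall x y, G x -> G y -> 0 <= Sform S (x - y) (x - y).

Definition max_S_monotone (S : 'M[R]_d) (G : set 'rV[R]_d) : Prop :=
  S_monotone S G /\
  forall H : set 'rV[R]_d, S_monotone S H -> G `<=` H -> H = G.

Definition psi (S : 'M[R]_d) (G : set 'rV[R]_d) (y : 'rV[R]_d) : \bar R :=
  ereal_sup [set (Sform S x y - Sform S x x / 2)%:E | x in G].

Definition PG (S : 'M[R]_d) (G : set 'rV[R]_d) (y : 'rV[R]_d) : set 'rV[R]_d :=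
  [set x | G x /\ forall x', G x' ->
     Sform S x' y - Sform S x' x' / 2 <= Sform S x y - Sform S x x / 2].

Definition SigmaP (S : 'M[R]_d) (G : set 'rV[R]_d) : set 'rV[R]_d :=
  [set y | PG S G y !=set0 /\ ~ (exists x, PG S G y = [set x])].

(* the map  y |-> P_G(y) 1_{y notin Sigma(P_G)}  (the unique element of P_G(y)
   where it is a singleton; 0 on Sigma(P_G) and, by convention, where P_G(y)
   is empty) *)
Definition PGmap (S : 'M[R]_d) (G : set 'rV[R]_d) (y : 'rV[R]_d) : 'rV[R]_d :=
  if `[< SigmaP S G y >] then 0 else xget 0 (PG S G y).

Section Prob.
Context (dO : measure_display) (O : measurableType dO) (P : probability O R).

Definition L2vec (Z : O -> 'rV[R]_d) : Prop :=
  @measurable_fun _ _ O Rd setT Z /\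
  forall i : 'I_d, P.-integrable setT (fun w => ((Z w 0 i) ^+ 2)%:E).

Definition sigma_measurable (X Y : O -> 'rV[R]_d) : Prop :=
  forall B : set Rd, measurable B ->
    exists B' : set Rd, measurable B' /\ X @^-1` B = Y @^-1` B'.

(* X is Y-measurable (up to a.s. equality, as X is an element of L_2) *)
Definition Y_measurable (X Y : O -> 'rV[R]_d) : Prop :=
  exists X' : O -> 'rV[R]_d, sigma_measurable X' Y /\
    {ae P, forall w, X w = X' w}.

(* E[Y | X] = X, i.e. E[Y 1_{X in B}] = E[X 1_{X in B}] for all Borel B *)
Definition condexp_id (X Y : O -> 'rV[R]_d) : Prop :=
  forall B : set Rd, measurable B -> forall i : 'I_d,
    (\int[P]_(w in X @^-1` B) (Y w 0 i)%:E =
     \int[P]_(w in X @^-1` B) (X w 0 i)%:E)%E.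

Definition calX (Y X : O -> 'rV[R]_d) : Prop :=
  [/\ L2vec X, Y_measurable X Y & condexp_id X Y].

Definition map_value (S : 'M[R]_d) (X Y : O -> 'rV[R]_d) : \bar R :=
  ((2^-1)%:E * \int[P]_w (Sform S (X w) (Y w))%:E)%E.

Definition optimal_map (S : 'M[R]_d) (Y X : O -> 'rV[R]_d) : Prop :=
  calX Y X /\
  forall X', calX Y X' -> (map_value S X' Y <= map_value S X Y)%E.

Definition law (Y : O -> 'rV[R]_d) : set Rd -> \bar R := pushforward P (Y : O -> Rd).

Definition dual_optimal (S : 'M[R]_d) (Y : O -> 'rV[R]_d) (G : set 'rV[R]_d) : Prop :=
  max_S_monotone S G /\
  forall H, max_S_monotone S H ->
    (\int[law Y]_y psi S G y <= \int[law Y]_y psi S H y)%E.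

Definition in_Gamma (Y : O -> 'rV[R]_d) (g : probability (Rd * Rd)%type R) : Prop :=
  [/\ (forall i : 'I_d,
        g.-integrable setT (fun z : Rd * Rd => (((z.1 : 'rV[R]_d) 0 i) ^+ 2)%:E) /\
        g.-integrable setT (fun z : Rd * Rd => (((z.2 : 'rV[R]_d) 0 i) ^+ 2)%:E)),
      (forall A : set Rd, measurable A -> g (snd @^-1` A) = law Y A) &
      (forall B : set Rd, measurable B -> forall i : 'I_d,
        (\int[g]_(z in fst @^-1` B) (((z.2 : 'rV[R]_d) 0 i))%:E =
         \int[g]_(z in fst @^-1` B) (((z.1 : 'rV[R]_d) 0 i))%:E)%E)].

Definition plan_value (S : 'M[R]_d) (g : probability (Rd * Rd)%type R) : \bar R :=
  ((2^-1)%:E * \int[g]_z (Sform S z.1 z.2)%:E)%E.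

Definition optimal_plan (S : 'M[R]_d) (Y : O -> 'rV[R]_d)
    (g : probability (Rd * Rd)%type R) : Prop :=
  in_Gamma Y g /\
  forall g', in_Gamma Y g' -> (plan_value S g' <= plan_value S g)%E.

End Prob.
End Defs.

(* Main.v *)
Require Import Defs.
From HB Require Import structures.
From mathcomp Require Import all_boot all_order all_algebra finmap.
From mathcomp Require Import all_classical all_reals all_analysis.
From mathcomp Require Import measurable_realfun ring lra.
Import Order.TTheory GRing.Theory Num.Theory.
Import numFieldNormedType.Exports.
Set Implicit Arguments. Unset Strict Implicit. Unset Printing Implicit Defensive.
Local Open Scope classical_set_scope.
Local Open Scope ring_scope.

(* Write q(x) = S(x,x)/2. A maximal S-monotone set G satisfies psi_G >= q with equality exactly
   on G, so psi_G is a convex majorant of q; conversely, every convex majorant of q dominates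
   some psi_H. Hence G minimizes the integral of all convex majorants of q, not just of the
   functions psi_H, and can be varied linearly: for a bounded field k, the function
   sup_(x in G) (S(x,y) - q(x) + t S(k(x), y - x)) + C t^2 is again a convex majorant of q,
   because every y has a Minty point x in G with q(x - y) = - Q(x - y), where Q = |S|/2.
   Differentiating at t = 0 gives E[S(k(X), Y - X)] = 0 for all test fields k, that is,
   E[Y|X] = X; a field pointing inwards at infinity shows that P_G(Y) is a.s. nonempty.
   For any martingale coupling (X', Y), the Minty projection pi onto G yields
   E psi_G(Y) >= E[S(pi(X'), Y) - q(pi(X'))] = E q(X') + E Q(X' - pi(X')) >= E S(X', Y)/2,
   with equality only if X' lies in P_G(Y) almost surely. *)

(** * Sign congruence of symmetric matrices *)

(** Two obstacles shape the argument: psi_G may be +oo or not attained, and X = P_G(Y) is not known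
    to be integrable when the dual problem is differentiated. Convex functions are therefore
    represented by convex subsets of the epigraph of q ordered by inclusion, where Zorn's lemma and
    closure arguments need no convention for infinite values. Differentiation is one-sided and rests
    on Fatou's lemma, because the difference quotients of the dual integrand have an integrable
    bound only from above. Coercivity of the field confines the near-maximizers to a compact set and
    produces the derivative -oo where P_G(Y) is empty. A field of bounded support is not coercive,
    so every test field carries a positive multiple of the inward field, which is removed by letting
    its factor be small. The inward field alone gives X a first moment; the second moment comes from
    E[Y|X] = X by truncation. The form Q is built from any congruence S = A diag(e) A^T with signs
    e, and so depends on the choice of A. What matters is that Q is positive definite, that -Q <= q
    <= Q, and that q + Q vanishes exactly on a linear subspace. *)

Section Congruence.
Variable R : realType.

(** Polarization: if the quadratic form vanishes identically, so does the bilinear form, whose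
    values on the unit vectors are the entries of S. *)
Lemma symmetric_nonisotropic n (S : 'M[R]_n) : S^T = S -> S != 0 ->
  exists v : 'rV[R]_n, (v *m S *m v^T) 0 0 != 0.
Proof.
move=> symS S0; apply: contrapT => /forallNP h.
have {}h (v : 'rV[R]_n) : (v *m S *m v^T) 0 0 = 0 by have [//|/(h v)] := eqVneq ((v *m S *m v^T) 0 0) 0.
case/negP: S0; apply/eqP/matrixP => i j; rewrite mxE.
pose b (x y : 'rV[R]_n) := (x *m S *m y^T) 0 0.
have bC x y : b x y = b y x.
  rewrite /b -[x *m S *m y^T]trmxK [in LHS]mxE !trmx_mul trmxK symS.
  by rewrite mulmxA.
have : b (delta_mx 0 i + delta_mx 0 j) (delta_mx 0 i + delta_mx 0 j) = 0 by exact: h.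
have bD x y : b (x + y) (x + y) = b x x + b y y + b x y *+ 2.
  have addE (M N : 'M[R]_1) : (M + N) 0 0 = M 0 0 + N 0 0 by rewrite mxE.
  rewrite {1}/b linearD /= mulmxDl mulmxDr !mulmxDl !addE -!/(b _ _).
  by rewrite (bC y x); ring.
rewrite bD ![b (delta_mx _ _) (delta_mx 0 i)]h ![b (delta_mx _ j) (delta_mx 0 j)]h !add0r => /eqP.
rewrite mulrn_eq0 /= => /eqP.
by rewrite /b -rowE trmx_delta -colE !mxE.
Qed.

(** Symmetric elimination: with a nonisotropic vector in front of the basis the upper left corner is
    invertible, and the induction runs on its Schur complement. *)
Lemma symmetric_congruent_diag n (S : 'M[R]_n) : S^T = S ->
  exists A : 'M[R]_n, exists e : 'rV[R]_n, A \in unitmx /\ S = A *m diag_mx e *m A^T.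
Proof.
elim: n S => [|n IH] S symS.
  exists 1%:M, 0; split; first by rewrite unitmx1.
  by apply/matrixP => -[].
have [->|S0] := eqVneq S 0.
  exists 1%:M, 0; split; first by rewrite unitmx1.
  by rewrite linear0 mulmx0 mul0mx.
have [v vSv] := symmetric_nonisotropic symS S0.
have v0 : v != 0.
  by apply: contraNneq vSv => ->; rewrite !mul0mx mxE.
(* The first row of this invertible matrix is a nonzero multiple of v, so the corner of [T] is a
   nonzero multiple of [v *m S *m v^T]. *)
pose B : 'M[R]_(1 + n) := row_ebase v.
have Bu : B \in unitmx by exact: row_ebase_unit.
have vE : v = (col_ebase v) 0 0 *: usubmx B.
  rewrite -[LHS]mulmx_ebase rank_rV v0 /=.
  rewrite [col_ebase v]mx11_scalar mul_scalar_mx -scalemxAl !mxE eqxx mulr1n; congr (_ *: _).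
  transitivity (row_mx 1%:M 0 *m col_mx (usubmx B) (dsubmx B)).
    by rewrite vsubmxK; congr (_ *m _); exact: pid_mx_row.
  by rewrite mul_row_col mul1mx mul0mx addr0.
pose T := B *m S *m B^T.
have symT : T^T = T by rewrite /T !trmx_mul trmxK symS mulmxA.
have TE : T = block_mx (ulsubmx T) (ursubmx T) (ursubmx T)^T (drsubmx T).
  by rewrite trmx_ursub symT submxK.
have a0 : (ulsubmx T) 0 0 != 0.
  apply: contraNneq vSv => a0; rewrite vE linearZ/= -!scalemxAl -scalemxAr.
  suff -> : usubmx B *m S *m (usubmx B)^T = ulsubmx T by rewrite mxE mxE a0 !mulr0.
  rewrite /T -[in RHS](vsubmxK B); move: (usubmx B) (dsubmx B) => U W.
  by rewrite tr_col_mx mul_col_mx /ulsubmx mul_col_mx col_mxKu mul_mx_row row_mxKl.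
move: TE; set a := ulsubmx T; set b := ursubmx T; set C := drsubmx T => TE.
have aE : a = (a 0 0)%:M by rewrite [LHS]mx11_scalar.
(* [L] is the elimination matrix and [C'] the Schur complement of the corner. *)
pose L : 'M[R]_(1 + n) := block_mx 1%:M 0 ((a 0 0)^-1 *: b^T) 1%:M.
pose C' := C - (a 0 0)^-1 *: (b^T *m b).
have symC : C'^T = C'.
  by rewrite /C' linearB linearZ /= trmx_mul trmxK /C trmx_drsub symT.
have [A' [e' [A'u C'E]]] := IH C' symC.
have TL : T = L *m block_mx a 0 0 C' *m L^T.
  rewrite /L tr_block_mx !trmx1 trmx0 linearZ /= trmxK !mulmx_block.
  rewrite ?(mul1mx, mulmx1, mulmx0, mul0mx, addr0, add0r) TE.
  have al p (M : 'M[R]_(1, p)) : a *m M = a 0 0 *: M by rewrite aE mul_scalar_mx !mxE eqxx mulr1n.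
  have ar p (M : 'M[R]_(p, 1)) : M *m a = a 0 0 *: M by rewrite aE mul_mx_scalar !mxE eqxx mulr1n.
  rewrite al ar !scalerA mulfV // !scale1r -scalemxAr; congr block_mx.
  by rewrite /C' addrC subrK.
have E2 : block_mx a 0 0 C' = block_mx 1%:M 0 0 A' *m diag_mx (row_mx a e') *m (block_mx 1%:M 0 0 A')^T.
  rewrite tr_block_mx !trmx0 trmx1 diag_mx_row !mulmx_block.
  rewrite ?(mul1mx, mulmx1, mulmx0, mul0mx, addr0, add0r) -C'E; congr block_mx.
  by apply/matrixP=> i j; rewrite !mxE (ord1 i) (ord1 j) eqxx mulr1n.
exists (invmx B *m L *m block_mx 1%:M 0 0 A'), (row_mx a e'); split.
  have Lu : L \in unitmx by rewrite unitmxE /L det_lblock !det1 mul1r unitr1.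
  have A'bu : block_mx 1%:M 0 0 A' \in @unitmx R (1 + n).
    by rewrite unitmxE det_lblock det1 mul1r -unitmxE.
  by rewrite !unitmx_mul unitmx_inv Bu Lu A'bu.
rewrite !trmx_mul !mulmxA.
have -> : invmx B *m L *m block_mx 1%:M 0 0 A' *m diag_mx (row_mx a e') *m
   (block_mx 1%:M 0 0 A')^T *m L^T *m (invmx B)^T = invmx B *m T *m (invmx B)^T.
  by rewrite TL E2 !mulmxA.
by rewrite /T !mulmxA mulVmx // mul1mx -mulmxA -trmx_mul mulVmx // trmx1 mulmx1.
Qed.

(** Invertibility of S excludes zeros on the diagonal; scaling by the roots of their absolute values
    leaves only signs. *)
Lemma symmetric_congruent_sign n (S : 'M[R]_n) : S^T = S -> S \in unitmx ->
  exists A : 'M[R]_n, exists e : 'rV[R]_n,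
    [/\ A \in unitmx, S = A *m diag_mx e *m A^T & forall i, e 0 i ^+ 2 = 1].
Proof.
move=> symS Su; have [A [e [Au SE]]] := symmetric_congruent_diag symS.
have eu : diag_mx e \in unitmx.
  by move: Su; rewrite SE !unitmx_mul unitmx_tr Au andbT.
have e0 i : e 0 i != 0.
  move: eu; rewrite unitmxE det_diag unitfE => /prodf_neq0; exact.
pose r := \row_i Num.sqrt `|e 0 i|; pose s := \row_i Num.sg (e 0 i).
exists (A *m diag_mx r), s; split.
- rewrite unitmx_mul Au unitmxE det_diag unitfE; apply/prodf_neq0 => i _.
  by rewrite mxE sqrtr_eq0 -ltNge normr_gt0.
- rewrite SE trmx_mul tr_diag_mx -!mulmxA; congr (_ *m _); rewrite !mulmxA; congr (_ *m _).
  rewrite !mulmx_diag; congr diag_mx; apply/rowP => i; rewrite !mxE.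
  by rewrite mulrC mulrA -expr2 sqr_sqrtr // mulrC -numEsg.
- by move=> i; rewrite mxE sqr_sg e0.
Qed.
End Congruence.

(** * The quadratic forms q and Q of a sign congruence *)

Section Forms.
Variables (R : realType) (d : nat).
Implicit Types (S A : 'M[R]_d) (x y z : 'rV[R]_d) (l : R).

Lemma SformDl S x y z : Sform S (x + y) z = Sform S x z + Sform S y z.
Proof. by rewrite /Sform !mulmxDl mxE. Qed.

Lemma SformDr S x y z : Sform S x (y + z) = Sform S x y + Sform S x z.
Proof. by rewrite /Sform linearD /= mulmxDr mxE. Qed.

Lemma SformZl S l x y : Sform S (l *: x) y = l * Sform S x y.
Proof. by rewrite /Sform -!scalemxAl mxE. Qed.

Lemma SformZr S l x y : Sform S x (l *: y) = l * Sform S x y.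
Proof. by rewrite /Sform linearZ /= -scalemxAr mxE. Qed.

Lemma SformNl S x y : Sform S (- x) y = - Sform S x y.
Proof. by rewrite -scaleN1r SformZl mulN1r. Qed.

Lemma SformNr S x y : Sform S x (- y) = - Sform S x y.
Proof. by rewrite -scaleN1r SformZr mulN1r. Qed.

Lemma Sform0l S y : Sform S 0 y = 0.
Proof. by rewrite -(scale0r 0) SformZl mul0r. Qed.

Lemma Sform0r S y : Sform S y 0 = 0.
Proof. by rewrite -(scale0r 0) SformZr mul0r. Qed.

Definition SformE := (SformDl, SformDr, SformNl, SformNr, SformZl, SformZr, Sform0l, Sform0r).

Lemma SformC S x y : S^T = S -> Sform S x y = Sform S y x.
Proof.
move=> symS; rewrite /Sform -[x *m S *m y^T]trmxK [in LHS]mxE !trmx_mul trmxK symS.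
by rewrite mulmxA.
Qed.

Lemma Sform_continuous (T : topologicalType) S (f g : T -> 'rV[R]_d) t :
  {for t, continuous f} -> {for t, continuous g} ->
  {for t, continuous (fun t => Sform S (f t) (g t))}.
Proof.
move=> cf cg.
have -> : (fun t => Sform S (f t) (g t)) =
    (fun t => \sum_j (\sum_i f t 0 i * S i j) * g t 0 j).
  apply/funext => u; rewrite /Sform mxE; apply: eq_bigr => j _.
  by rewrite !mxE.
have cc (h : T -> 'rV[R]_d) i : {for t, continuous h} -> h u 0 i @[u --> t] --> h t 0 i.
  by move=> ch; apply: (@cvg_comp _ _ _ h (fun v : 'rV[R]_d => v 0 i) _ _ _ ch); exact: coord_continuous.
rewrite /continuous_at /=; apply: cvg_big => [|j _]; first exact: add_continuous.
apply: cvgM; last exact: cc.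
apply: cvg_big => [|i _]; first exact: add_continuous.
by apply: cvgM; [exact: cc|exact: cvg_cst].
Qed.

Definition qf S x := Sform S x x / 2.

(** An exact identity: for [A *m A^T] the last term expresses strong convexity, for the indefinite S
    it measures how far q is from being convex. *)
Lemma qf_convex_comb S x y l : S^T = S ->
  qf S (l *: x + (1 - l) *: y) = l * qf S x + (1 - l) * qf S y - l * (1 - l) * qf S (x - y).
Proof. by move=> symS; rewrite /qf !SformE (SformC y x symS); field. Qed.

Lemma qfB S x y : S^T = S -> qf S (x - y) = qf S x + qf S y - Sform S x y.
Proof. by move=> symS; rewrite /qf !SformE (SformC y x symS); field. Qed.

Lemma qfD S x y : S^T = S -> qf S (x + y) = qf S x + qf S y + Sform S x y.
Proof. by move=> symS; rewrite /qf !SformE (SformC y x symS); field. Qed.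

Lemma qfZ S l x : qf S (l *: x) = l ^+ 2 * qf S x.
Proof. by rewrite /qf !SformE; field. Qed.

Lemma qfN S x : qf S (- x) = qf S x.
Proof. by rewrite /qf !SformE opprK. Qed.

Lemma qf_continuous S : continuous (qf S).
Proof.
move=> x; have h : {for x, continuous (fun t => Sform S t t)}.
  by apply: Sform_continuous; exact: cvg_id.
by apply: (@cvgM _ _ _ _ (fun t => Sform S t t) (fun=> 2^-1) _ _ h); exact: cvg_cst.
Qed.

(* [A A^T] is the absolute value of [S = A diag(e) A^T]; it plays the role of |S|. *)
Definition sign_congruence S A (e : 'rV[R]_d) :=
  [/\ A \in unitmx, S = A *m diag_mx e *m A^T & forall i, e 0 i ^+ 2 = 1].

Section SignCongruence.
Variables (S A : 'M[R]_d) (e : 'rV[R]_d).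
Hypothesis SA : sign_congruence S A e.

Let K := A *m A^T.
(** Acting on rows from the right, this involution multiplies coordinate i of [x *m A] by the sign
    [e 0 i]. It exchanges the forms S and [A *m A^T], as the fundamental symmetry of a Krein space
    does. *)
Definition Jmx A (e : 'rV[R]_d) := A *m diag_mx e *m invmx A.

Lemma sign_congruence_sym : S^T = S.
Proof. by have [_ -> _] := SA; rewrite !trmx_mul trmxK tr_diag_mx mulmxA. Qed.

Lemma mulmx_trmx_sym : (A *m A^T)^T = A *m A^T.
Proof. by rewrite trmx_mul trmxK. Qed.

Lemma Sform_coord x y : Sform S x y = \sum_i e 0 i * (x *m A) 0 i * (y *m A) 0 i.
Proof.
have [_ -> _] := SA; rewrite /Sform !mulmxA -mulmxA -trmx_mul mxE.
by apply: eq_bigr => i _; rewrite mul_mx_diag !mxE (mulrC (e 0 i)).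
Qed.

Lemma Kform_coord x y : Sform K x y = \sum_i (x *m A) 0 i * (y *m A) 0 i.
Proof.
rewrite /Sform !mulmxA -mulmxA -trmx_mul mxE.
by apply: eq_bigr => i _; rewrite !mxE.
Qed.

Lemma mulJA x i : (x *m Jmx A e *m A) 0 i = e 0 i * (x *m A) 0 i.
Proof.
have [Au _ _] := SA.
by rewrite /Jmx !mulmxA mulmxKV // mul_mx_diag mxE mulrC.
Qed.

Lemma Sform_J x y : Sform S (x *m Jmx A e) y = Sform K x y.
Proof.
rewrite Sform_coord Kform_coord; apply: eq_bigr => i _; rewrite mulJA.
by have [_ _ /(_ i) e1] := SA; rewrite mulrA -expr2 e1 mul1r.
Qed.

Lemma qf_J x : qf S (x *m Jmx A e) = qf S x.
Proof.
rewrite /qf !Sform_coord; congr (_ / _); apply: eq_bigr => i _; rewrite mulJA.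
have [_ _ /(_ i) e1] := SA.
by rewrite -!mulrA mulrCA (mulrCA _ (e 0 i)) mulrA (mulrA (e 0 i)) -expr2 e1 mul1r.
Qed.

Lemma Qf_J x : qf K (x *m Jmx A e) = qf K x.
Proof.
rewrite /qf !Kform_coord; congr (_ / _); apply: eq_bigr => i _; rewrite mulJA.
have [_ _ /(_ i) e1] := SA.
by rewrite mulrACA -expr2 e1 mul1r.
Qed.

Lemma Qf_ge0 x : 0 <= qf K x.
Proof. by rewrite /qf Kform_coord divr_ge0 // sumr_ge0 // => i _; rewrite -expr2 sqr_ge0. Qed.

Lemma sign_cases i : e 0 i = 1 \/ e 0 i = -1.
Proof. by have [_ _ /(_ i) /eqP] := SA; rewrite sqrf_eq1 => /orP[] /eqP; [left|right]. Qed.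

Lemma qf_le_Qf x : qf S x <= qf K x.
Proof.
rewrite /qf Sform_coord Kform_coord ler_pM2r ?invr_gt0 //; apply: ler_sum => i _.
by have := sqr_ge0 ((x *m A) 0 i); case: (sign_cases i) => ->; nra.
Qed.

Lemma qf_ge_NQf x : - qf K x <= qf S x.
Proof.
rewrite /qf Sform_coord Kform_coord -mulNr ler_pM2r ?invr_gt0 // -sumrN; apply: ler_sum => i _.
by have := sqr_ge0 ((x *m A) 0 i); case: (sign_cases i) => ->; nra.
Qed.

Lemma Sform_ge_NQf x y : - qf K x - qf K y <= Sform S x y.
Proof.
rewrite /qf Sform_coord !Kform_coord -mulNr -mulrBl ler_pdivrMr // mulr_suml -sumrN -sumrB.
apply: ler_sum => i _.
have := sqr_ge0 ((x *m A) 0 i + (y *m A) 0 i); have := sqr_ge0 ((x *m A) 0 i - (y *m A) 0 i).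
by rewrite !expr2; case: (sign_cases i) => ->; nra.
Qed.

Lemma Sform_le_Qf x y : Sform S x y <= qf K x + qf K y.
Proof.
have := Sform_ge_NQf (- x) y; rewrite SformNl qfN -/K; lra.
Qed.

Lemma Qf_eq0 x : qf K x <= 0 -> x = 0.
Proof.
move=> Kx; have [Au _ _] := SA.
have /eqP : qf K x = 0 by apply/eqP; rewrite eq_le Kx Qf_ge0.
rewrite /qf mulf_eq0 invr_eq0 pnatr_eq0 orbF Kform_coord psumr_eq0; last first.
  by move=> i _; rewrite -expr2 sqr_ge0.
move=> /allP h; suff xA : x *m A = 0 by rewrite -(mulmxK Au x) xA mul0mx.
apply/rowP => i; rewrite [RHS]mxE; apply/eqP.
by have /= := h i (mem_index_enum i); rewrite -expr2 sqrf_eq0.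
Qed.

(* The null vectors of the positive semidefinite form q + Q form a subspace: the negative space. *)
Lemma negative_spaceP z : qf S z <= - qf K z <-> z *m Jmx A e = - z.
Proof.
split=> [h|h]; last by rewrite /qf -(Sform_J z z) h SformNl -/K; lra.
have h2 i : (1 + e 0 i) * (z *m A) 0 i = 0.
  have ge0 j : 0 <= (1 + e 0 j) * (z *m A) 0 j ^+ 2.
    by apply: mulr_ge0; [case: (sign_cases j) => ->; lra|exact: sqr_ge0].
  have : \sum_j (1 + e 0 j) * (z *m A) 0 j ^+ 2 == 0.
    rewrite eq_le sumr_ge0 // andbT.
    move: h; rewrite /qf Sform_coord Kform_coord -subr_ge0 -opprD oppr_ge0 -mulrDl -big_split /=.
    rewrite pmulr_lle0 ?invr_gt0 // => h; apply: le_trans h; apply: ler_sum => j _.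
    by rewrite expr2 mulrDl mul1r mulrA.
  rewrite psumr_eq0 // => /allP /(_ i (mem_index_enum i)) /=.
  by rewrite mulf_eq0 sqrf_eq0 => /orP[]/eqP ->; rewrite ?mul0r ?mulr0.
apply/eqP; rewrite -addr_eq0 addrC; apply/eqP.
have [Au _ _] := SA; suff xA : (z + z *m Jmx A e) *m A = 0.
  by rewrite -(mulmxK Au (z + _)) xA mul0mx.
by apply/rowP => i; rewrite mulmxDl mxE mulJA [RHS]mxE -(h2 i) mulrDl mul1r.
Qed.

Lemma negative_spaceB x y : qf S x <= - qf K x -> qf S y <= - qf K y ->
  qf S (x - y) <= - qf K (x - y).
Proof.
move=> /negative_spaceP hx /negative_spaceP hy; apply/negative_spaceP.
by rewrite mulmxBl hx hy opprB opprK addrC.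
Qed.

End SignCongruence.
End Forms.

(** * Maximal convex sets above the graph of q *)

(** The limit l -> 0 in a convexity inequality already divided by l; this is how first-order
    conditions are extracted below. *)
Lemma ler_lim_1Bl (R : realType) (a b : R) :
  (forall l, 0 < l <= 1 -> (1 - l) * b <= a) -> b <= a.
Proof.
move=> h; have [//|ab] := leP b a.
have a0 : 0 <= a by have := h 1; rewrite subrr mul0r; apply; rewrite ltr01 lexx.
have b0 : 0 < b by exact: le_lt_trans ab.
(* With this l, [(1 - l) * b] is the midpoint of a and b. *)
have := h ((b - a) / (2 * b)); have -> : 0 < (b - a) / (2 * b) <= 1.
  rewrite divr_gt0 ?subr_gt0 ?mulr_gt0 //= ler_pdivrMr ?mulr_gt0 // mul1r; lra.
have -> : (1 - (b - a) / (2 * b)) * b = (a + b) / 2 by field; rewrite gt_eqF.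
by move=> /(_ isT); lra.
Qed.

Section MaximalConvex.
Variables (R : realType) (d : nat) (S A : 'M[R]_d) (e : 'rV[R]_d).
Hypothesis SA : sign_congruence S A e.
Implicit Types (E : set ('rV[R]_d * R)) (p : 'rV[R]_d * R) (x y z : 'rV[R]_d).

Let symS : S^T = S   := sign_congruence_sym SA.

Definition comb (l : R) p p' : 'rV[R]_d * R :=
  (l *: p.1 + (1 - l) *: p'.1, l * p.2 + (1 - l) * p'.2).

(* Convex sets of pairs inside the epigraph of q stand for convex functions above q. *)
Definition convex_above_q E :=
  (forall p p' l, E p -> E p' -> 0 <= l <= 1 -> E (comb l p p')) /\
  (forall p, E p -> qf S p.1 <= p.2).

(** A larger epigraph is a smaller function: maximal sets stand for minimal convex majorants of
    q. *)
Definition maximal_convex_above_q E := convex_above_q E /\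
  forall E', convex_above_q E' -> E `<=` E' -> E' `<=` E.

(** Zorn's lemma is applied to the sets whose union with [E0] is convex above q, so that the empty
    chain needs no separate treatment. *)
Lemma exists_maximal_convex_above_q E0 : convex_above_q E0 ->
  exists E, E0 `<=` E /\ maximal_convex_above_q E.
Proof.
move=> cE0; pose P := [set E | convex_above_q (E0 `|` E)].
have [|E [PE maxE]] := @Zorn_bigcup _ P.
  move=> F FP totF; split.
    have key p p' l X : F X -> (E0 `|` X) p -> (E0 `|` X) p' -> 0 <= l <= 1 ->
        (E0 `|` \bigcup_(X in F) X) (comb l p p').
      move=> FX Xp Xp' l01; have [c _] := FP _ FX.
      by have [?|?] := c _ _ _ Xp Xp' l01; [left|right; exists X].
    move=> p p' l [Ep|[X FX Xp]] [Ep'|[X' FX' Xp']] l01.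
    - by left; apply: cE0.1.
    - by apply: (key _ _ _ X') => //; [left|right].
    - by apply: (key _ _ _ X) => //; [right|left].
    - have [XX'|X'X] := totF _ _ FX FX'.
        by apply: (key _ _ _ X') => //; right => //; exact: XX'.
      by apply: (key _ _ _ X) => //; right => //; exact: X'X.
  move=> p [Ep|[X FX Xp]]; first exact: cE0.2.
  by have [_] := FP _ FX; apply; right.
exists (E0 `|` E); split; first by move=> p; left.
split=> // E' cE' EE'; apply: contrapT => nE'E; apply: (maxE E').
  split; first by move=> p Ep; apply: EE'; right.
  by move=> E'E; apply: nE'E => p /E'E; right.
by rewrite /P /= setUidr // => p Ep; apply: EE'; left.
Qed.

Section Maximal.
Variable E : set ('rV[R]_d * R).
Hypothesis maxE : maximal_convex_above_q E.

(** The convex hull of E and (x0, c) stays above q, since q(l x0 + (1 - l) y) = l^2 q(x0) + (1 -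
    l)^2 q(y) + l (1 - l) S(x0, y); maximality then puts the point into E. For the function f with
    epigraph E this says that f lies below the larger of q and the S-conjugate of f. *)
Lemma maximal_polar_mem x0 (c : R) p1 : E p1 -> qf S x0 <= c ->
  (forall p, E p -> Sform S x0 p.1 <= c + p.2) -> E (x0, c).
Proof.
move=> Ep1 qc polar; have [[cE aE] mE] := maxE.
pose E' := [set p | exists l, exists p', [/\ 0 <= l <= 1, E p' & p = comb l (x0, c) p']].
apply: (mE E'); last 1 first.
- exists 1, p1; split=> //; first by rewrite ler01 lexx.
  by rewrite /comb /= subrr scale0r addr0 scale1r mul0r addr0 mul1r.
- split=> [_ _ s [l1 [r1 [/andP[l10 l11] Er1 ->]]] [l2 [r2 [/andP[l20 l21] Er2 ->]]]
         /andP[s0 s1] | _ [l [r [/andP[l0 l1] Er ->]]]].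
    (* [L] is the total weight of (x0, c) and [m] below the share of [r1] in the remaining weight.
       If [L] is 1, the points of E carry no weight and [p1] serves as a dummy. *)
    pose L := s * l1 + (1 - s) * l2.
    have L0 : 0 <= L by rewrite addr_ge0 // mulr_ge0 // subr_ge0.
    have L1 : L <= 1 by rewrite /L; nra.
    have [L1E|Ln1] := eqVneq L 1.
      exists 1, p1; split=> //; first by rewrite ler01 lexx.
      have c1 : s * (1 - l1) = 0.
        have : 0 <= s * (1 - l1) by apply: mulr_ge0; rewrite ?subr_ge0.
        have : 0 <= (1 - s) * (1 - l2) by apply: mulr_ge0; rewrite ?subr_ge0.
        move: L1E; rewrite /L; nra.
      have c2 : (1 - s) * (1 - l2) = 0 by move: L1E c1; rewrite /L; nra.
      rewrite /comb /= !scalerDr !scalerA c1 c2 !scale0r !addr0 -scalerDl -/L L1E.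
      rewrite subrr scale0r addr0; congr (_, _).
      rewrite mul0r addr0 !mulrDr !mulrA c1 c2 !mul0r !addr0 -mulrDl -/L L1E //.
    have L1' : 1 - L != 0 by rewrite subr_eq0 eq_sym.
    have L1p : 0 < 1 - L by rewrite lt_neqAle eq_sym L1' subr_ge0.
    pose m := s * (1 - l1) / (1 - L).
    have mE' : 1 - m = (1 - s) * (1 - l2) / (1 - L).
      by rewrite /m; apply: (mulIf L1'); rewrite mulrBl !divfK // mul1r /L; ring.
    exists L, (comb m r1 r2); split; first by rewrite L0.
      apply: cE => //; rewrite -(subr_ge0 m) mE'.
      by rewrite !divr_ge0 ?mulr_ge0 ?subr_ge0.
    rewrite /comb /= mE'; congr (_, _).
      rewrite !scalerDr !scalerA !(mulrC (1 - L)) !divfK // addrACA -scalerDl -/L //.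
    by move: L1'; rewrite /m /L => ?; field.
  rewrite /comb /= qf_convex_comb //.
  have := polar _ Er; have := aE _ Er; have := qfB x0 r.1 symS.
  move: qc; set a := qf S x0; set b := qf S r.1; set t := Sform S x0 r.1.
  set u := qf S _; move=> qc uE br tc.
  have h1 : 0 <= l * (1 - l) * (c + r.2 - t).
    by rewrite mulr_ge0 ?mulr_ge0 ?subr_ge0.
  have h2 : 0 <= l * l * (c - a) by rewrite mulr_ge0 ?mulr_ge0 ?subr_ge0.
  have h3 : 0 <= (1 - l) * (1 - l) * (r.2 - b) by rewrite mulr_ge0 ?mulr_ge0 ?subr_ge0.
  rewrite -subr_ge0; apply: le_trans (addr_ge0 h1 (addr_ge0 h2 h3)) _.
  by rewrite uE le_eqVlt; apply/orP; left; apply/eqP; ring.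
- move=> p Ep; exists 0, p; split=> //; first by rewrite ler01 lexx.
  by case: p {Ep} => u v; rewrite /comb /= subr0 scale0r add0r scale1r mul0r add0r mul1r.
Qed.

(** The points approximated by E form, by continuity of q, again a convex set above q, which
    maximality absorbs. *)
Lemma maximal_closed : closed E.
Proof.
have [[cE aE] mE] := maxE.
pose E' := [set p | forall eps, 0 < eps -> exists p', [/\ E p', `|p.1 - p'.1| <= eps & `|p.2 - p'.2| <= eps]].
suff E'E : E' `<=` E.
  move=> p clp; apply: E'E => eps eps0.
  have [|p' [Ep' [b1 b2]]] := clp (ball p eps); first exact: nbhsx_ballx.
  exists p'; split => //; apply: ltW.
    by move: b1; rewrite -ball_normE.
  by move: b2; rewrite -ball_normE.
apply: mE; last first.
  by move=> p Ep eps /ltW eps0; exists p; rewrite !subrr !normr0.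
split=> [p p' l E'p E'p' /andP[l0 l1] eps eps0|p E'p].
  have [r [Er r1 r2]] := E'p _ eps0; have [r' [Er' r1' r2']] := E'p' _ eps0.
  exists (comb l r r'); split; first by apply: cE => //; rewrite l0.
    rewrite /comb /= opprD addrACA -!scalerBr (le_trans (ler_normD _ _)) // !normrZ.
    rewrite (ger0_norm l0) ger0_norm ?subr_ge0 //.
    have /= := ler_wpM2l l0 r1; have l1' : 0 <= 1 - l by rewrite subr_ge0.
    by have /= := ler_wpM2l l1' r1'; move: (`|p.1 - _|) (`|p'.1 - _|) => *; nra.
  rewrite /comb /= opprD addrACA -!mulrBr (le_trans (ler_normD _ _)) // !normrM.
  rewrite (ger0_norm l0) (ger0_norm (_ : 0 <= 1 - l)) ?subr_ge0 //.
  have /= := ler_wpM2l l0 r2; have l1' : 0 <= 1 - l by rewrite subr_ge0.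
  by have /= := ler_wpM2l l1' r2'; move: (`|p.2 - _|) (`|p'.2 - _|) => *; nra.
apply/ler_addgt0Pr => eps eps0.
have /cvgrPdist_le /(_ (eps / 2)) := @qf_continuous _ _ S p.1.
have e20 : 0 < eps / 2 by rewrite divr_gt0.
move=> /(_ e20) /nbhs_ballP [del /= del0 hdel].
have m0 : 0 < Num.min (del / 2) (eps / 2) by rewrite lt_min !divr_gt0.
have [p' [Ep' /= d1 d2]] := E'p _ m0.
have := hdel p'.1; rewrite -ball_normE /= => /(_ _).
have h1 : `|p.1 - p'.1| < del.
  rewrite (le_lt_trans d1) // gt_min; apply/orP; left.
  by rewrite ltr_pdivrMr // ltr_pMr // ltr1n.
move=> /(_ h1); have := aE _ Ep'.
have : `|p.2 - p'.2| <= eps / 2 by rewrite (le_trans d2) // ge_min lexx orbT.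
rewrite !ler_norml => /andP[? ?] ? /andP[? ?]; lra.
Qed.

Definition contact_set := [set x | E (x, qf S x)].

(** A convex function above q that touches q at x is supported there by the tangent of q: compare
    both along the segment from x to p and let the weight of p tend to 0. *)
Lemma contact_set_support x p : contact_set x -> E p -> Sform S x p.1 - qf S x <= p.2.
Proof.
move=> Ex Ep; have [[cE aE] _] := maxE.
have : qf S p.1 - qf S (x - p.1) <= p.2.
  suff : - qf S (x - p.1) <= p.2 - qf S p.1 by lra.
  apply: ler_lim_1Bl => l /andP[l0 l1].
  have l01 : 0 <= 1 - l <= 1 by rewrite subr_ge0 l1 lerBlDr lerDl ltW.
  have := aE _ (cE _ _ _ Ex Ep l01); rewrite /comb /= qf_convex_comb // subKr => h.
  have : 0 <= l * (p.2 - qf S p.1 + (1 - l) * qf S (x - p.1)) by nra.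
  by rewrite pmulr_rge0 //; lra.
by rewrite qfB //; lra.
Qed.

Lemma contact_set_monotone : S_monotone S contact_set.
Proof.
move=> x y Hx Hy; have := contact_set_support Hx Hy; rewrite /=.
have := qfB x y symS; rewrite {1}/qf; lra.
Qed.

End Maximal.
End MaximalConvex.

(** * Minty's theorem for maximal S-monotone sets *)

Section RowNorm.
Variables (R : realType) (d : nat).

Lemma row_norm_le (x : 'rV[R]_d) (r : R) : 0 <= r ->
  (forall i, `|x 0 i| <= r) -> `|x| <= r.
Proof.
move=> r0 h; rewrite [leLHS]/Num.Def.normr /= mx_normrE; apply/bigmax_leP; split => //= -[i j] _ /=.
by rewrite (ord1 i).
Qed.

Lemma coord_le_norm (x : 'rV[R]_d) i : `|x 0 i| <= `|x|.
Proof.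
rewrite [leRHS]/Num.Def.normr /= mx_normrE; apply/bigmax_geP; right => /=.
by exists (0, i).
Qed.

Lemma closed_le_fun (T : topologicalType) (f : T -> R) (a : R) :
  continuous f -> closed [set x | f x <= a].
Proof. by move=> cf; apply: (@preimage_closed _ _ f [set r | r <= a]) => // x _; exact: cf. Qed.

End RowNorm.

Section Coercive.
Variables (R : realType) (d : nat) (S A : 'M[R]_d) (e : 'rV[R]_d).
Hypothesis SA : sign_congruence S A e.
Implicit Types (x y z : 'rV[R]_d).
Let K := A *m A^T.

(** The Euclidean norm of [x *m A], because 2 Q(x) is the sum of the squares of its coordinates. *)
Definition Knorm (x : 'rV[R]_d) := Num.sqrt (2 * qf K x).

Lemma Knorm_ge0 x : 0 <= Knorm x. Proof. exact: sqrtr_ge0. Qed.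

Lemma Knorm_sqr x : Knorm x ^+ 2 = 2 * qf K x.
Proof. by rewrite sqr_sqrtr // mulr_ge0 // Qf_ge0. Qed.

Lemma Kcoord_le_Knorm x i : `|(x *m A) 0 i| <= Knorm x.
Proof.
rewrite -sqrtr_sqr ler_wsqrtr // /qf mulrC divfK //.
by rewrite Kform_coord (bigD1 i) //= -expr2 lerDl sumr_ge0 // => j _; rewrite -expr2 sqr_ge0.
Qed.

Lemma norm_le_Knorm : exists2 C : R, 0 < C & forall x, `|x| <= C * Knorm x.
Proof.
pose C := 1 + \sum_j \sum_i `|invmx A i j|.
have C1 : 1 <= C by rewrite lerDl sumr_ge0 // => j _; rewrite sumr_ge0.
exists C; first exact: lt_le_trans C1.
move=> x; have C0 : 0 <= C by exact: le_trans C1.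
apply: row_norm_le => [|j]; first by rewrite mulr_ge0 // Knorm_ge0.
have [Au _ _] := SA; rewrite -(mulmxK Au x) [in `|_|]mxE.
apply: le_trans (ler_norm_sum _ _ _) _.
rewrite (mulmxK Au x); apply: (@le_trans _ _ ((\sum_i `|invmx A i j|) * Knorm x)).
  rewrite mulr_suml; apply: ler_sum => i _; rewrite normrM mulrC.
  by apply: ler_wpM2l => //; exact: Kcoord_le_Knorm.
apply: ler_wpM2r; first exact: Knorm_ge0.
suff : \sum_i `|invmx A i j| <= \sum_j \sum_i `|invmx A i j| by rewrite /C; lra.
by rewrite [leRHS](bigD1 j) //= lerDl sumr_ge0 // => i _; rewrite sumr_ge0.
Qed.

Lemma Knorm_continuous : continuous Knorm.
Proof.
move=> x; apply: (@continuous_comp _ _ _ (fun x => 2 * qf K x) Num.sqrt).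
  by apply: continuousM; [exact: cst_continuous|exact: qf_continuous].
exact: sqrt_continuous.
Qed.

Lemma Kball_compact y0 (r : R) : compact [set y | qf K (y - y0) <= r].
Proof.
have cc : continuous (fun y => qf K (y - y0)).
  move=> y; apply: (@continuous_comp _ _ _ (fun y => y - y0) (qf K)); last exact: qf_continuous.
  by apply: continuousB; [exact: cvg_id|exact: cst_continuous].
apply: bounded_closed_compact; last exact: closed_le_fun.
have [C C0 hC] := norm_le_Knorm.
exists (C * Num.sqrt (2 * r) + `|y0|); split; first exact: num_real.
move=> t ht y /= hy; apply: le_trans (ltW ht).
rewrite -(subrK y0 y) (le_trans (ler_normD _ _)) // lerD2r (le_trans (hC _)) //.
rewrite ler_pM2l // ler_wsqrtr //; lra.
Qed.

(** Cauchy-Schwarz, from Q(|y| x - |x| y) >= 0. *)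
Lemma Kform_le_Knorm x y : Sform K x y <= Knorm x * Knorm y.
Proof.
have [x0|x0] := eqVneq (Knorm x) 0.
  suff -> : x = 0 by rewrite Sform0l mulr_ge0 // Knorm_ge0.
  by apply: (Qf_eq0 SA); have := Knorm_sqr x; rewrite x0; rewrite expr2 mulr0 -/K; lra.
have [y0|y0] := eqVneq (Knorm y) 0.
  suff -> : y = 0 by rewrite Sform0r mulr_ge0 // Knorm_ge0.
  by apply: (Qf_eq0 SA); have := Knorm_sqr y; rewrite y0; rewrite expr2 mulr0 -/K; lra.
have xp : 0 < Knorm x by rewrite lt_neqAle eq_sym x0 Knorm_ge0.
have yp : 0 < Knorm y by rewrite lt_neqAle eq_sym y0 Knorm_ge0.
have := Qf_ge0 A (Knorm y *: x - Knorm x *: y); rewrite qfB ?mulmx_trmx_sym // !qfZ -/K !SformE.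
have hx := Knorm_sqr x; have hy := Knorm_sqr y.
have -> : Knorm y ^+ 2 * qf K x + Knorm x ^+ 2 * qf K y - Knorm y * (Knorm x * Sform K x y)
   = Knorm x * Knorm y * (Knorm x * Knorm y - Sform K x y).
  have -> : qf K x = Knorm x ^+ 2 / 2 by rewrite hx; field.
  have -> : qf K y = Knorm y ^+ 2 / 2 by rewrite hy; field.
  by field.
by rewrite pmulr_rge0 ?mulr_gt0 // subr_ge0.
Qed.
End Coercive.

Section Minty.
Variables (R : realType) (d : nat) (S A : 'M[R]_d) (e : 'rV[R]_d).
Hypothesis SA : sign_congruence S A e.
Implicit Types (E : set ('rV[R]_d * R)) (p : 'rV[R]_d * R) (x y z : 'rV[R]_d).
Let K := A *m A^T.
Let symS : S^T = S   := sign_congruence_sym SA.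
Let symK : K^T = K := mulmx_trmx_sym A.

(** On E this is at least q(p.1 - z) + Q(p.1 - z) >= 0, and it vanishes exactly when p lies on the
    graph of q and p.1 - z in the negative space. A zero of [f z] in E is thus a Minty point of
    z. *)
Let f z p := p.2 - Sform S z p.1 + qf S z + qf K (p.1 - z).

Let f_comb z l p p' :
  f z (comb l p p') = l * f z p + (1 - l) * f z p' - l * (1 - l) * qf K (p.1 - p'.1).
Proof.
rewrite /f /comb /=; have -> : l *: p.1 + (1 - l) *: p'.1 - z = l *: (p.1 - z) + (1 - l) *: (p'.1 - z).
  rewrite !scalerBr addrACA -opprD -scalerDl addrCA subrr addr0 scale1r //.
rewrite qf_convex_comb //.
have -> : p.1 - z - (p'.1 - z) = p.1 - p'.1 by rewrite opprB addrA subrK.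
by rewrite !SformE; ring.
Qed.

Let f_ge0 E z p : convex_above_q S E -> E p -> 0 <= f z p.
Proof.
move=> [_ aE] /aE h; rewrite /f.
have := qf_ge_NQf SA (p.1 - z); rewrite -/K (qfB _ _ symS) (SformC z p.1 symS); lra.
Qed.

(** Strong convexity of [f z] bounds its sublevel sets, so a minimizer exists by compactness; the
    same identity yields the quadratic growth away from it. *)
Let f_min E z p1 : maximal_convex_above_q S E -> E p1 ->
  exists2 p, E p & forall p', E p' -> f z p + qf K (p'.1 - p.1) <= f z p'.
Proof.
move=> mE Ep1; have [[cE aE] _] := mE.
have lb : has_lbound (f z @` E) by exists 0 => _ [p Ep <-]; apply: (f_ge0 _ mE.1).
have hinf : has_inf (f z @` E) by split => //; exists (f z p1), p1.
set I := inf (f z @` E).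
have Ile p : E p -> I <= f z p by move=> Ep; apply: ge_inf => //; exists p.
have [_ [p0 Ep0 <-] p0I] := inf_adherent ltr01 hinf; rewrite -/I in p0I.
pose g y := - Sform S z y + qf S z + qf K (y - z).
have cg : continuous g.
  move=> y.
  apply: (@continuousD _ _ _ (fun y => - Sform S z y + qf S z) (fun y => qf K (y - z))); last first.
    apply: (@continuous_comp _ _ _ (fun y => y - z) (qf K)); last exact: qf_continuous.
    by apply: continuousB; [exact: cvg_id|exact: cst_continuous].
  apply: (@continuousD _ _ _ (fun y => - Sform S z y) (fun=> qf S z)); last exact: cst_continuous.
  by apply: continuousN; apply: Sform_continuous; [exact: cst_continuous|exact: cvg_id].
(* Two points of E with values at most [I + 1] have a midpoint of value at least [I], hence Q of
   their difference is at most 4. *)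
pose B := [set y | qf K (y - p0.1) <= 4].
have cB : compact B by exact: (Kball_compact SA).
have B0 : B !=set0 by exists p0.1; rewrite /B /= subrr /qf Sform0l mul0r.
have [c1 _ hc1] := compact_EVT_min B0 cB (continuous_subspaceT (@qf_continuous _ _ S)).
have [c2 _ hc2] := compact_EVT_min B0 cB (continuous_subspaceT cg).
pose L := E `&` [set p | f z p <= I + 1].
have LB p : L p -> B p.1.
  move=> [Ep /= fp]; have l01 : 0 <= (2^-1 : R) <= 1 by lra.
  by have := Ile _ (cE _ _ _ Ep Ep0 l01); rewrite f_comb /B /=; lra.
have fE : f z = fun p => p.2 + g p.1 by apply/funext => p; rewrite /f /g; ring.
have cf : continuous (f z).
  rewrite fE => p; apply: (@continuousD _ _ _ snd (g \o fst)); first exact: cvg_snd.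
  by apply: (@continuous_comp _ _ _ fst g); [exact: cvg_fst|exact: cg].
have cL : compact L.
  apply: (@subclosed_compact _ _ (B `*` `[qf S c1, I + 1 - g c2])).
  - by apply: closedI; [exact: (maximal_closed mE)|exact: closed_le_fun].
  - by apply: compact_setX => //; exact: segment_compact.
  - move=> p Lp; have Bp := LB _ Lp; split => //=; rewrite in_itv /=; case: Lp => Ep fp.
    apply/andP; split; first by apply: le_trans (aE _ Ep); apply: hc1; rewrite inE.
    have := hc2 p.1; rewrite inE => /(_ Bp); move: fp; rewrite fE /=; lra.
have L0 : L !=set0 by exists p0; split => //=; exact: ltW.
have [p /[!inE] -[Ep fp] pmin] := compact_EVT_min L0 cL (continuous_subspaceT cf).
have {}pmin p' : E p' -> f z p <= f z p'.
  move=> Ep'; have [fp'|fp'] := leP (f z p') (I + 1); first by apply: pmin; rewrite inE.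
  by rewrite (le_trans fp) // ltW.
exists p => // p' Ep'.
suff : qf K (p'.1 - p.1) <= f z p' - f z p by lra.
apply: ler_lim_1Bl => l /andP[l0 l1].
have l01 : 0 <= l <= 1 by rewrite ltW.
have := pmin _ (cE _ _ _ Ep' Ep l01); rewrite f_comb => h.
have : 0 <= l * (f z p' - f z p - (1 - l) * qf K (p'.1 - p.1)) by nra.
by rewrite pmulr_rge0 // subr_ge0.
Qed.

(** The minimizer p of [f z] has a subgradient u, and maximality forces q(u) <= c for the
    corresponding conjugate value c. Expanded, this inequality is f(z, p) <= - Q(x - z) - q(x - z)
    <= 0, so p is a zero of [f z]. *)
Lemma maximal_minty E z p1 : maximal_convex_above_q S E -> E p1 ->
  exists2 x, contact_set S E x & qf S (x - z) <= - qf K (x - z).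
Proof.
move=> mE Ep1; have [p Ep pmin] := f_min z mE Ep1.
have [[cE aE] _] := mE.
set x := p.1 in pmin *; set w := x - z; pose u := z - w *m Jmx A e.
have ju y : Sform S u y = Sform S z y - Sform K w y.
  by rewrite /u SformDl SformNl (Sform_J SA).
pose c := Sform S u x - p.2.
(* The quadratic growth at p cancels the quadratic part of Q(p'.1 - z), and an affine inequality
   remains. *)
have polar p' : E p' -> Sform S u p'.1 <= c + p'.2.
  move=> /pmin; rewrite /f /c !ju -/x -/w.
  have -> : p'.1 - z = w + (p'.1 - x) by rewrite /w [RHS]addrC addrA subrK.
  by rewrite (qfD w _ symK) !SformE; lra.
have qu : qf S u = qf S z - Sform K w z + qf S w.
  by rewrite /u qfB // (SformC _ _ symS) (Sform_J SA) (qf_J SA); ring.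
have cu : qf S u <= c.
  (* If c < q(u), the point (u, q(u)) would belong to E, and testing [polar] on it would give 2 q(u)
     <= c + q(u). *)
  rewrite leNgt; apply/negP => cu.
  have Eu : E (u, qf S u).
    apply: (maximal_polar_mem SA mE Ep1) => // p' Ep'.
    by apply: le_trans (polar _ Ep') _; rewrite lerD2r ltW.
  by have /= := polar _ Eu; move: cu; rewrite /qf; lra.
have fle : f z p <= 0.
  move: cu; rewrite qu /c ju /f -/x -/w.
  have -> : Sform K w x = Sform K w z + 2 * qf K w.
    have xE : z + w = x by rewrite /w addrCA subrr addr0.
    by rewrite -[in LHS]xE SformDr /qf; field.
  have := qf_ge_NQf SA w; rewrite -/K; lra.
have := aE _ Ep; have := qf_ge_NQf SA w; move: fle; rewrite /f -/x -/w -/K.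
have qw : qf S w = qf S x + qf S z - Sform S z x by rewrite /w qfB // (SformC x z).
move=> h1 h2 h3; exists x; last by rewrite -/w qw; lra.
rewrite /contact_set /=; have -> : qf S x = p.2 by lra.
by rewrite /x -surjective_pairing.
Qed.

(** A point z of a larger monotone set and its Minty point x satisfy 0 <= q(x - z) <= - Q(x - z), so
    they coincide. *)
Lemma max_S_monotone_of_minty (H : set 'rV[R]_d) : S_monotone S H ->
  (forall z, exists2 x, H x & qf S (x - z) <= - qf K (x - z)) -> max_S_monotone S H.
Proof.
move=> mH minty; split => // H' mH' HH'; apply/seteqP; split => // z H'z.
have [x Hx xz] := minty z.
suff -> : z = x by [].
apply/eqP; rewrite eq_sym -subr_eq0; apply/eqP; apply: (Qf_eq0 SA).
have : 0 <= qf S (x - z) by rewrite /qf divr_ge0 // mH' //; exact: HH'.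
by rewrite -/K; lra.
Qed.

(** H is the contact set of a maximal extension of E. It keeps all points where E already touches q,
    which later identifies H with a given maximal set. *)
Lemma exists_max_S_monotone_below E p1 : convex_above_q S E -> E p1 ->
  exists H, [/\ max_S_monotone S H,
    forall x p, H x -> E p -> Sform S x p.1 - qf S x <= p.2,
    (forall x, E (x, qf S x) -> H x) &
    forall z, exists2 x, H x & qf S (x - z) <= - qf K (x - z)].
Proof.
move=> cE Ep1; have [E' [EE' mE']] := exists_maximal_convex_above_q cE.
have mi z := maximal_minty z mE' (EE' _ Ep1).
exists (contact_set S E'); split => //.
- by apply: max_S_monotone_of_minty => //; exact: (contact_set_monotone SA mE').
- by move=> x p Hx Ep; apply: (contact_set_support SA mE') => //; exact: EE'.
- by move=> x /EE'.
Qed.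

(** The epigraph of psi_G touches q on G, so the contact set of a maximal extension contains G. It
    equals G by maximality, and G inherits its Minty points. *)
Lemma max_S_monotone_minty G : max_S_monotone S G ->
  forall z, exists2 x, G x & qf S (x - z) <= - qf K (x - z).
Proof.
move=> [mG maxG].
pose E := [set p : 'rV[R]_d * R | forall x, G x -> Sform S x p.1 - qf S x <= p.2].
have GE x : G x -> E (x, qf S x).
  move=> Gx x' Gx' /=; have := mG x' x Gx' Gx.
  by have := qfB x' x symS; rewrite {1}/qf; lra.
have cE : convex_above_q S E.
  split=> [p p' l Ep Ep' /andP[l0 l1] x Gx | p Ep].
    have := Ep x Gx; have := Ep' x Gx; rewrite /comb /= !SformE; nra.
  (* A point where psi_G is below q would be in strictly positive relation to all of G, hence belong
     to G, hence be in strictly positive relation to itself. *)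
  rewrite leNgt; apply/negP => ep.
  have pos x : G x -> 0 < qf S (x - p.1).
    by move=> Gx; have := Ep x Gx; rewrite qfB //; lra.
  have Gp : G p.1.
    rewrite -(maxG (G `|` [set p.1])); [by right| |by move=> x; left].
    move=> x y [Gx|->] [Gy|->]; first exact: mG.
    - by have := pos _ Gx; rewrite /qf; lra.
    - rewrite -opprB SformNl SformNr opprK.
      by have := pos _ Gy; rewrite /qf; lra.
    - by rewrite subrr Sform0l.
  by have := pos _ Gp; rewrite subrr /qf Sform0l mul0r ltxx.
have [x0 Gx0] : G !=set0.
  apply/set0P/negP => /eqP G0.
  have : [set (0 : 'rV[R]_d)] = G.
    apply: maxG => [x y -> ->|]; first by rewrite subrr Sform0l.
    by rewrite G0.
  by rewrite G0 => /seteqP[+ _] => /(_ 0); apply.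
have [H [mH _ EH mi]] := exists_max_S_monotone_below cE (GE _ Gx0).
by rewrite -(maxG H) // ?mH.1 //; [case: mH|move=> x /GE /EH].
Qed.

End Minty.

(** * The functions psi_G of maximal sets and their variations *)

Section Psi.
Variables (R : realType) (d : nat) (S : 'M[R]_d).
Implicit Types (x y z : 'rV[R]_d) (G : set 'rV[R]_d).

Lemma psi_ge G x y : G x -> ((Sform S x y - qf S x)%:E <= psi S G y)%E.
Proof. by move=> Gx; apply: ereal_sup_ubound; exists x. Qed.

Lemma psi_le G y (M : \bar R) :
  (forall x, G x -> ((Sform S x y - qf S x)%:E <= M)%E) -> (psi S G y <= M)%E.
Proof. by move=> h; apply: ge_ereal_sup => _ [x Gx <-]; exact: h. Qed.

Lemma PGP G y x : PG S G y x <-> G x /\ psi S G y = (Sform S x y - qf S x)%:E.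
Proof.
split=> [[Gx h]|[Gx h]]; split => //.
  by apply/eqP; rewrite eq_le psi_ge // andbT; apply: psi_le => x' /h; rewrite lee_fin.
by move=> x' Gx'; rewrite -lee_fin -[leRHS]h; exact: psi_ge.
Qed.

End Psi.

Section MaximalSets.
Variables (R : realType) (d : nat) (S A : 'M[R]_d) (e : 'rV[R]_d).
Hypothesis SA : sign_congruence S A e.
Implicit Types (x y z : 'rV[R]_d).
Let K := A *m A^T.
Let symS : S^T = S := sign_congruence_sym SA.
Let symK : K^T = K := mulmx_trmx_sym A.

(** Q is itself a convex majorant of q. The set H obtained from it shows that the dual value is
    finite. *)
Lemma exists_psi_le_Qf : exists2 H, max_S_monotone S H & forall y, (psi S H y <= (qf K y)%:E)%E.
Proof.
pose E := [set p : 'rV[R]_d * R | qf K p.1 <= p.2].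
have E0 : E (0, 0) by rewrite /E /= /qf Sform0l mul0r.
have cE : convex_above_q S E.
  split=> [p p' l Ep Ep' /andP[l0 l1]|p Ep]; last exact: le_trans (qf_le_Qf SA _) Ep.
  rewrite /E /comb /= qf_convex_comb //; rewrite /E /= in Ep Ep'.
  have : 0 <= l * (1 - l) * qf K (p.1 - p'.1).
    by rewrite mulr_ge0 ?Qf_ge0 // mulr_ge0 // subr_ge0.
  by nra.
have [H [mH HE _ _]] := exists_max_S_monotone_below SA cE E0.
by exists H => // y; apply: psi_le => x Hx; rewrite lee_fin; apply: (HE x (y, qf K y)) => //; exact: lexx.
Qed.

Variable G : set 'rV[R]_d.
Hypothesis mG : max_S_monotone S G.

(** The Minty point x of y gives S(x, y) - q(x) = q(y) - q(x - y) >= q(y) + Q(x - y). *)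
Lemma max_S_monotone_psi_ge y : ((qf S y)%:E <= psi S G y)%E.
Proof.
have [x Gx xy] := max_S_monotone_minty SA mG y.
apply: le_trans (psi_ge S y Gx); rewrite lee_fin.
by have := Qf_ge0 A (x - y); move: xy; rewrite (qfB _ _ symS) -/K; lra.
Qed.

Lemma max_S_monotone_neq0 : G !=set0.
Proof. by have [x Gx _] := max_S_monotone_minty SA mG 0; exists x. Qed.

Lemma max_S_monotone_psi_mem y : G y -> (psi S G y <= (qf S y)%:E)%E.
Proof.
move=> Gy; apply: psi_le => x Gx; rewrite lee_fin.
by have := mG.1 x y Gx Gy; have := qfB x y symS; rewrite {1}/qf; lra.
Qed.

(** A maximal set consists of all points in monotone relation to it, and each of these relations is
    closed. *)
Lemma max_S_monotone_closed : closed G.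
Proof.
have -> : G = \bigcap_(x in G) [set z | - Sform S (z - x) (z - x) <= 0].
  apply/seteqP; split => [z Gz x Gx|z h]; first by rewrite /= oppr_le0 mG.1.
  have {}h x : G x -> 0 <= Sform S (z - x) (z - x) by move=> /h /=; rewrite oppr_le0.
  rewrite -(mG.2 (G `|` [set z])); [by right| |by move=> x; left].
  move=> x y [Gx|->] [Gy|->]; [exact: mG.1| |exact: h|by rewrite subrr Sform0l].
  by rewrite -opprB SformNl SformNr opprK h.
apply: closed_bigI => x _; apply: closed_le_fun => z.
apply: (@continuousN _ _ _ (fun z => Sform S (z - x) (z - x))).
by apply: Sform_continuous; apply: continuousB; try exact: cvg_id; exact: cst_continuous.
Qed.

(* The Minty projection of R^d onto G along the negative space of S. *)
Lemma exists_minty_projection : exists pi : 'rV[R]_d -> 'rV[R]_d,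
  [/\ forall z, G (pi z), forall z, qf S (pi z - z) <= - qf K (pi z - z) &
      forall z z', qf K (pi z - pi z') <= 2 * qf K (z - z')].
Proof.
have /choice[pi hpi] z : exists x, G x /\ qf S (x - z) <= - qf K (x - z).
  by have [x Gx xz] := max_S_monotone_minty SA mG z; exists x.
exists pi; split => [z|z|z z']; [exact: (hpi z).1|exact: (hpi z).2|].
set w := pi z - pi z'; set u := z - z'.
have wu : qf S (w - u) <= - qf K (w - u).
  have -> : w - u = (pi z - z) - (pi z' - z').
    by rewrite /w /u !opprD !opprK addrACA.
  by apply: (negative_spaceB SA); exact: (hpi _).2.
have qw : 0 <= qf S w by rewrite /qf divr_ge0 // mG.1 //; exact: (hpi _).1.
have qv := qf_ge_NQf SA (w - u); have qu := qf_le_Qf SA u.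
(* On the negative space S(w - u, .) = - K(w - u, .), so q + Q takes the same value at w and at u.
   The factor 2 follows from q(w) >= 0 and q(u) <= Q(u). *)
have Jneg : (w - u) *m Jmx A e = - (w - u) by exact/(negative_spaceP SA).
have SK : Sform S (w - u) u = - Sform K (w - u) u.
  by rewrite -(Sform_J SA) Jneg SformNl opprK.
have e1 := qfD (w - u) u symS; have e2 := qfD (w - u) u symK; rewrite !subrK in e1 e2.
have : qf S (w - u) = - qf K (w - u) by apply/eqP; rewrite eq_le wu qv.
by rewrite -/K in qu *; lra.
Qed.

Section Variation.
Variables (k : 'rV[R]_d -> 'rV[R]_d) (C : R) (M : 'rV[R]_d -> R).
Hypothesis kC : forall x, qf K (k x) <= C.
Hypothesis kM : forall x y, Sform S (k x) (y - x) <= M y.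

(* Moving each x in G by t k(x) keeps the supremum of the moved affine functions above q,
   up to t^2 C: at y use the Minty point of y, where q(x - y) = - Q(x - y) absorbs the
   first-order term. *)
Lemma exists_psi_variation t : 0 <= t -> exists2 H, max_S_monotone S H &
  forall y (a : R),
    (forall x, G x -> Sform S x y - qf S x + t * Sform S (k x) (y - x) <= a) ->
    (psi S H y <= (a + t ^+ 2 * C)%:E)%E.
Proof.
move=> t0.
pose E := [set p : 'rV[R]_d * R | forall x, G x ->
  Sform S x p.1 - qf S x + t * Sform S (k x) (p.1 - x) + t ^+ 2 * C <= p.2].
have [y0 Gy0] := max_S_monotone_neq0.
have E0 : E (y0, qf S y0 + t * M y0 + t ^+ 2 * C).
  move=> x Gx /=; rewrite lerD2r lerD ?ler_wpM2l //.
  by rewrite -lee_fin (le_trans (psi_ge S y0 Gx)) // max_S_monotone_psi_mem.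
have cE : convex_above_q S E.
  split=> [p p' l Ep Ep' /andP[l0 l1] x Gx|p Ep].
    by have := Ep x Gx; have := Ep' x Gx; rewrite /comb /= !SformE; nra.
  have [x Gx xy] := max_S_monotone_minty SA mG p.1.
  apply: le_trans (Ep x Gx).
  (* This bounds t S(k(x), y - x) below by - t^2 Q(k(x)) - Q(y - x): the Minty point pays for the
     second term, [t ^+ 2 * C] for the first. *)
  have h1 := Sform_ge_NQf SA (t *: k x) (p.1 - x); rewrite SformZl qfZ -/K in h1.
  have h2 : t ^+ 2 * qf K (k x) <= t ^+ 2 * C by rewrite ler_wpM2l ?sqr_ge0.
  rewrite (qfB _ _ symS) -[qf (A *m A^T) _]qfN opprB -/K in xy.
  lra.
have [H [mH HE _ _]] := exists_max_S_monotone_below SA cE E0.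
exists H => // y a ha; apply: psi_le => x Hx; rewrite lee_fin.
by apply: (HE x (y, a + t ^+ 2 * C)) => // x' Gx' /=; rewrite lerD2r; exact: ha.
Qed.

Variable c : R.
Hypothesis c0 : 0 < c.
Hypothesis kcoercive : forall x y, Sform S (k x) (y - x) <= M y - c * Knorm A x.
Hypothesis kcont : continuous k.

(** The upper half of Danskin's theorem. The points of G where the derivative is at least L form a
    compact set by coercivity; it contains no maximizer, so its distance D from the supremum is
    positive and small t cannot close the gap. If [PG S G y] is empty, every L is admissible and the
    derivative is -oo. *)
Lemma variation_derivative_le y (L : R) : psi S G y \is a fin_num ->
  (forall x, PG S G y x -> Sform S (k x) (y - x) < L) ->
  exists2 t0, 0 < t0 & forall t, 0 <= t <= t0 -> forall x, G x ->
    Sform S x y - qf S x + t * Sform S (k x) (y - x) <= fine (psi S G y) + t * L.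
Proof.
move=> fpsi hL.
have hpsi x : G x -> Sform S x y - qf S x <= fine (psi S G y).
  by move=> Gx; rewrite -lee_fin fineK //; exact: psi_ge.
pose B := G `&` [set x | - Sform S (k x) (y - x) <= - L].
have notB x t : 0 <= t -> G x -> ~ B x -> 
    Sform S x y - qf S x + t * Sform S (k x) (y - x) <= fine (psi S G y) + t * L.
  move=> t0 Gx nB; rewrite lerD ?hpsi // ler_wpM2l // leNgt; apply/negP => h.
  by apply: nB; split => //=; rewrite lerN2 ltW.
have [B0|] := eqVneq B set0.
  exists 1 => // t /andP[t0 _] x Gx; apply: notB => //; by rewrite B0.
move=> /set0P B0.
have ck : continuous (fun x => Sform S (k x) (y - x)).
  move=> x; apply: (@Sform_continuous _ _ _ S k (fun x => y - x)); first exact: kcont.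
  by apply: continuousB; [exact: cst_continuous|exact: cvg_id].
have cB : compact B.
  apply: (@subclosed_compact _ _ [set x | qf K (x - 0) <= ((M y - L) / c) ^+ 2 / 2]).
  - apply: closedI; first exact: max_S_monotone_closed.
    by apply: closed_le_fun => x; apply: (@continuousN _ _ _ (fun x => Sform S (k x) (y - x))); exact: ck.
  - exact: (Kball_compact SA).
  - move=> x [Gx /=]; rewrite lerN2 subr0 => /le_trans /(_ (kcoercive x y)) h.
    have := Knorm_sqr A x; have := Knorm_ge0 A x; rewrite -/K => n0 nE.
    have hn : Knorm A x <= (M y - L) / c by rewrite ler_pdivlMr //; lra.
    have : Knorm A x ^+ 2 <= ((M y - L) / c) ^+ 2 by rewrite lerXn2r // nnegrE // (le_trans n0).
    by rewrite nE; lra.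
have cphi : continuous (fun x => Sform S x y - qf S x).
  move=> x; apply: (@continuousB _ _ _ (Sform S ^~ y) (qf S)); last exact: qf_continuous.
  by apply: (@Sform_continuous _ _ _ S id (fun=> y)); [exact: cvg_id|exact: cst_continuous].
have [x0 /[!inE] Bx0 x0max] := compact_EVT_max B0 cB (continuous_subspaceT cphi).
have [Gx0 /=] := Bx0; rewrite lerN2 => Lx0.
have gap : Sform S x0 y - qf S x0 < fine (psi S G y).
  rewrite lt_neqAle hpsi // andbT; apply/eqP => x0E.
  have /hL : PG S G y x0 by apply/PGP; rewrite x0E fineK.
  by rewrite ltNge Lx0.
have LM : L <= M y by rewrite (le_trans Lx0).
pose D := fine (psi S G y) - (Sform S x0 y - qf S x0).
have D0 : 0 < D by rewrite subr_gt0.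
have m0 : 0 < M y - L + 1 by lra.
(* Since L <= M y, the added 1 keeps the denominator positive. *)
exists (D / (M y - L + 1)); first by rewrite divr_gt0.
move=> t /andP[t0 tD] x Gx; have [Bx|nBx] := pselect (B x); last exact: notB.
have h1 : Sform S x y - qf S x <= Sform S x0 y - qf S x0 by apply: x0max; rewrite inE.
have h2 : t * Sform S (k x) (y - x) <= t * M y by rewrite ler_wpM2l.
have : t * (M y - L + 1) <= D by rewrite -ler_pdivlMr.
by rewrite /D; nra.
Qed.

End Variation.
End MaximalSets.

(** * Borel measurability of psi and of the argmax map *)

Section BorelRow.
Variables (R : realType) (d : nat).
Local Notation Rd := (Rd R d).

Lemma open_measurable_row (U : set 'rV[R]_d) : open U -> measurable (U : set Rd).
Proof. by move=> oU; apply: sub_sigma_algebra. Qed.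

Lemma closed_measurable_row (F : set 'rV[R]_d) : closed F -> measurable (F : set Rd).
Proof.
move=> cF; rewrite -[F]setCK; apply: measurableC.
by apply: open_measurable_row; rewrite openC.
Qed.

Lemma measurable_fun_row d' (T : measurableType d') (f : T -> Rd) :
  (forall U : set 'rV[R]_d, closed U -> measurable (f @^-1` U)) -> measurable_fun setT f.
Proof.
move=> h; apply: (@measurability _ _ T Rd setT f (@open 'rV[R]_d)) => //.
move=> _ [U oU <-]; rewrite setTI -[U]setCK preimage_setC; apply: measurableC.
by apply: (h (~` U)); exact: open_closedC.
Qed.

Lemma continuous_measurable_row (f : 'rV[R]_d -> 'rV[R]_d) :
  continuous f -> @measurable_fun _ _ Rd Rd setT f.
Proof.
move=> cf; apply: measurable_fun_row => U cU; apply: closed_measurable_row.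
by apply: preimage_closed => // x _; exact: cf.
Qed.

Lemma lower_semicontinuous_measurable_row (f : 'rV[R]_d -> \bar R) :
  (forall a : R, open [set x | (a%:E < f x)%E]) -> @measurable_fun _ _ Rd _ setT f.
Proof.
move=> h; apply: (measurability _ (ErealGenOInfty.measurableE R)).
move=> /= _ [_ [a ->]] <-; apply: measurableI => //; apply: open_measurable_row.
by rewrite preimage_itvoy; exact: h.
Qed.

Lemma continuous_measurable_real (f : 'rV[R]_d -> R) :
  continuous f -> @measurable_fun _ _ Rd _ setT f.
Proof.
move=> cf; apply/measurable_EFinP; apply: lower_semicontinuous_measurable_row => a.
rewrite (_ : [set x | _] = f @^-1` [set r | a < r]); last first.
  by apply/seteqP; split => x /=; rewrite lte_fin.
by apply: open_comp => [x _|]; [exact: cf|exact: open_gt].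
Qed.

Variable S : 'M[R]_d.

(** G may be uncountable, so measurability comes from lower semicontinuity: a superlevel set is a
    union of open sets. *)
Lemma psi_measurable (G : set 'rV[R]_d) : @measurable_fun _ _ Rd _ setT (psi S G).
Proof.
apply: lower_semicontinuous_measurable_row => a.
rewrite (_ : [set x | _] = \bigcup_(x in G) [set y | a < Sform S x y - qf S x]).
  apply: bigcup_open => x Gx; apply: (@open_comp _ _ (fun y => Sform S x y - qf S x) [set r | a < r]) => [y _|].
    apply: (@continuousB _ _ _ (Sform S x) (fun=> qf S x)); last exact: cst_continuous.
    by apply: (@Sform_continuous _ _ _ S (fun=> x) id); [exact: cst_continuous|exact: cvg_id].
  exact: open_gt.
apply/seteqP; split => [y /= /ereal_sup_gt[_ [x Gx <-]]|y [x Gx /= ay]].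
  by rewrite lte_fin => h; exists x.
by apply: lt_le_trans (psi_ge S y Gx); rewrite lte_fin.
Qed.

Section Argmax.
Variable G : set 'rV[R]_d.
Hypothesis cG : closed G.
Hypothesis psiNy : forall y, psi S G y != -oo%E.

Let hits (F : set 'rV[R]_d) := [set y | PG S G y `&` F !=set0].

(** By compactness, some maximizer lies in F exactly where the suprema over G and over its part in F
    agree, and both are measurable in y. *)
Lemma PG_compact_measurable F : compact F -> measurable (hits F : set Rd).
Proof.
move=> cF; have cGF : compact (G `&` F).
  apply: (subclosed_compact _ cF) => //.
  by apply: closedI => //; exact: compact_closed.
rewrite (_ : hits F = setT `&` [set y | psi S G y = psi S (G `&` F) y]).
  by apply: (@measurable_eqe _ Rd) => //; exact: psi_measurable.
apply/seteqP; split => [y [x [/PGP[Gx px] Fx]]|y [_ /= h]].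
  split => //=; apply/eqP; rewrite eq_le; apply/andP; split.
    by rewrite px; apply: psi_ge.
  by apply: psi_le => x' [Gx' _]; exact: psi_ge.
(* The supremum over the empty set is -oo, a value that [psiNy] excludes. *)
have [GF0|/set0P GF0] := eqVneq (G `&` F) set0.
  by have := psiNy y; rewrite h /psi GF0 image_set0 ereal_sup0 eqxx.
have cphi : continuous (fun x => Sform S x y - qf S x).
  move=> x; apply: (@continuousB _ _ _ (Sform S ^~ y) (qf S)); last exact: qf_continuous.
  by apply: (@Sform_continuous _ _ _ S id (fun=> y)); [exact: cvg_id|exact: cst_continuous].
have [x /[!inE] -[Gx Fx] xmax] := compact_EVT_max GF0 cGF (continuous_subspaceT cphi).
exists x; split => //; apply/PGP; split => //; rewrite h; apply/eqP; rewrite eq_le psi_ge // andbT.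
by apply: psi_le => x' GFx'; rewrite lee_fin; apply: xmax; rewrite inE.
Qed.

Lemma PG_closed_measurable F : closed F -> measurable (hits F : set Rd).
Proof.
move=> cF.
rewrite (_ : hits F = \bigcup_n hits (F `&` [set x | `|x| <= n%:R])).
  apply: bigcup_measurable => n _; apply: PG_compact_measurable.
  apply: bounded_closed_compact.
    exists n%:R; split; first exact: num_real.
    by move=> t nt x [_ /= xn]; rewrite (le_trans xn) // ltW.
  by apply: closedI => //; apply: closed_le_fun => x; exact: norm_continuous.
apply/seteqP; split => [y [x [Px Fx]]|y [n _ [x [Px [Fx _]]]]]; last by exists x.
exists (Num.truncn `|x|).+1 => //; exists x; split => //; split => //=.
by rewrite ltW // truncnS_gt.
Qed.

(** Two different maximizers are separated in some coordinate by two rationals a < b, which makes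
    the set a countable union. *)
Lemma SigmaP_measurable : measurable (SigmaP S G : set Rd).
Proof.
pose I := ('I_d * rat * rat)%type.
pose F1 (j : I) := hits [set x | x 0 j.1.1 <= ratr j.1.2].
pose F2 (j : I) := hits [set x | - x 0 j.1.1 <= - ratr j.2].
have cc i : continuous (fun x : 'rV[R]_d => x 0 i) by move=> x; exact: coord_continuous.
rewrite (_ : SigmaP S G = \bigcup_j (if j.1.2 < j.2 then F1 j `&` F2 j else set0)).
  apply: countable_bigcupT_measurable; first exact: countableP.
  move=> j; case: ifP => // _; apply: measurableI; apply: PG_closed_measurable.
    by apply: closed_le_fun; exact: cc.
  by apply: closed_le_fun => x; apply: (@continuousN _ _ _ (fun x : 'rV[R]_d => x 0 j.1.1)); exact: cc.
apply/seteqP; split => [y [[x Px] n1]|y [[[i a] b] _]] /=.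
  have [x' Px' x'x] : exists2 x', PG S G y x' & x' != x.
    apply: contrapT => h; apply: n1; exists x; apply/seteqP; split => [z Pz|z ->//].
    by apply/eqP; apply: contrapT => zx; apply: h; exists z => //; exact/negP.
  have [i xi] : exists i, x 0 i != x' 0 i.
    apply/existsP; rewrite -negb_forall; apply: contra x'x => /forallP h.
    by apply/eqP/rowP => i; apply/esym/eqP.
  wlog lt : x x' Px Px' xi {x'x} / x 0 i < x' 0 i.
    move=> W; have [|h|h] := ltgtP (x 0 i) (x' 0 i); first exact: W.
      by apply: (W x' x) => //; rewrite eq_sym.
    by rewrite h eqxx in xi.
  have [a] := rat_in_itvoo lt; rewrite in_itv /= => /andP[xa ax'].
  have [b] := rat_in_itvoo ax'; rewrite in_itv /= => /andP[ab bx'].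
  exists (i, a, b) => //=; rewrite -(@ltr_rat R) ab; split.
    by exists x; split => //=; exact: ltW.
  by exists x'; split => //=; rewrite lerN2 ltW.
case: ifP => // ab [[x [Px /= xa]] [x' [Px' /=]]]; rewrite lerN2 => bx'.
split; first by exists x.
move=> [z zE]; move: Px Px'; rewrite zE /= => xz x'z.
by move: xa bx'; rewrite xz x'z => h /le_trans /(_ h); rewrite ler_rat leNgt ab.
Qed.

Lemma PGmap_measurable : @measurable_fun _ _ Rd Rd setT (PGmap S G).
Proof.
apply: measurable_fun_row => F cF.
have mS := SigmaP_measurable; have mT := PG_closed_measurable (@closedT _).
have hT y : hits setT y <-> PG S G y !=set0.
  by split=> [[x []]|[x Px]]; exists x.
(* The second set collects the points sent to the default value 0, those of [SigmaP] and those
   without a maximizer. *)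
rewrite (_ : _ @^-1` F = (~` SigmaP S G `&` hits F) `|`
    (if 0 \in F then SigmaP S G `|` ~` hits setT else set0)).
  apply: measurableU.
    by apply: measurableI; [exact: measurableC|exact: PG_closed_measurable].
  by case: ifP => // _; apply: measurableU => //; exact: measurableC.
have single y : ~ SigmaP S G y -> PG S G y !=set0 -> exists x, PG S G y = [set x].
  by move=> nS n0; apply: contrapT => h; apply: nS.
apply/seteqP; split => y /=; rewrite /PGmap.
  case: asboolP => [Sy F0|nSy]; first by right; rewrite mem_set //; left.
  have [P0|P0] := pselect (PG S G y !=set0).
    by have [x Px] := single _ nSy P0; rewrite Px (@xget_unique _ _ _ x) // => Fx; left; split => //; exists x; rewrite Px.
  have -> : xget 0 (PG S G y) = 0 by apply: xgetPN => x Px; apply: P0; exists x.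
  by move=> F0; right; rewrite mem_set //; right; apply: contra_not P0 => /hT.
case=> [[nSy [x [Px Fx]]]|].
  have [//|x' Px'] := single _ nSy; first by exists x.
  by case: asboolP => // _; rewrite Px' (@xget_unique _ _ _ x') //; move: Px; rewrite Px' => <-.
case: ifP => // /[!inE] F0 [Sy|nT]; first by case: asboolP.
case: asboolP => // _.
have -> // : xget 0 (PG S G y) = 0.
by apply: xgetPN => x Px; apply: nT; apply/hT; exists x.
Qed.

End Argmax.
End BorelRow.

(** * Integration of martingale couplings *)

Section RealIntegrable.
Import HBNNSimple.
Context (dT : measure_display) (T : measurableType dT) (R : realType).
Variable mu : probability T R.
Implicit Types (f g Z : T -> R).

Definition rint f := mu.-integrable setT (EFin \o f).

Lemma rint_measurable f : rint f -> measurable_fun setT f.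
Proof. by move=> /integrableP[/measurable_EFinP]. Qed.

Lemma rint_cst (c : R) : rint (fun=> c).
Proof. exact: finite_measure_integrable_cst. Qed.

Lemma rintD f g : rint f -> rint g -> rint (fun w => f w + g w).
Proof. by move=> /(@integrableD _ _ _ _ _ measurableT) h /h. Qed.

Lemma rintZ (c : R) f : rint f -> rint (fun w => c * f w).
Proof. by move=> /(@integrableZl _ _ _ _ _ measurableT c). Qed.

Lemma rintN f : rint f -> rint (fun w => - f w).
Proof. by move=> /(rintZ (-1)); congr (rint _); apply/funext => w; rewrite mulN1r. Qed.

Lemma rintB f g : rint f -> rint g -> rint (fun w => f w - g w).
Proof. by move=> hf hg; apply: rintD => //; exact: rintN. Qed.

Lemma rint_le f g : measurable_fun setT f -> (forall w, `|f w| <= g w) -> rint g -> rint f.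
Proof.
move=> mf fg ig; apply: le_integrable ig => //; first exact/measurable_EFinP.
by move=> w _ /=; rewrite lee_fin (le_trans (fg w)) // ler_norm.
Qed.

Lemma rint_abs f : rint f -> rint (fun w => `|f w|).
Proof.
move=> hf; apply: (@rint_le _ (fun w => `|f w|)) => [|w|].
- by apply: measurableT_comp => //; exact: rint_measurable.
- by rewrite normr_id.
- by move/integrable_abse : hf.
Qed.

Lemma rint_sum (I : finType) (h : I -> T -> R) :
  (forall i, rint (h i)) -> rint (fun w => \sum_i h i w).
Proof.
move=> hh; rewrite /rint (_ : EFin \o _ = (fun w => \sum_i (h i w)%:E)%E).
  by apply: integrable_sum => // i _; exact: hh.
by apply/funext => w /=; rewrite sumEFin.
Qed.

(** Simple functions of X reduce the claim to the events of the hypothesis. The limit is dominated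
    by |f(X) Z|, so that f may be unbounded. *)
Lemma measurable_cond_integral0 d' (T' : measurableType d') (X : T -> T') Z (f : T' -> R) :
  measurable_fun setT X -> rint Z ->
  (forall B, measurable B -> (\int[mu]_(w in X @^-1` B) (Z w)%:E = 0)%E) ->
  measurable_fun setT f -> (forall x, 0 <= f x) -> rint (fun w => f (X w) * Z w) ->
  \int[mu]_w (f (X w) * Z w) = 0.
Proof.
move=> mX iZ hZ mf f0 ifZ.
have mEf : measurable_fun setT (EFin \o f) by exact/measurable_EFinP.
pose fn := nnsfun_approx measurableT mEf.
have fncvg x : fn n x @[n --> \oo] --> f x.
  have /= := @cvg_nnsfun_approx _ _ _ setT measurableT _ mEf (fun x _ => f0 x) x I.
  by move/fine_cvgP => [_].
have fnle n x : fn n x <= f x.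
  rewrite -(cvg_lim _ (fncvg x)) //; apply: nondecreasing_cvgn_le; last by apply/cvg_ex; exists (f x).
  by move=> a b ab; have /lefP := nd_nnsfun_approx measurableT mEf ab; exact.
have fn0 n x : 0 <= fn n x by [].
have mfnX n : measurable_fun setT (fun w => fn n (X w)) by apply: measurableT_comp.
have mZ := rint_measurable iZ.
have ifn n : rint (fun w => fn n (X w) * Z w).
  apply: (@rint_le _ (fun w => `|f (X w) * Z w|)); last exact: rint_abs.
    by apply: measurable_funM.
  by move=> w; rewrite !normrM ler_wpM2r // !ger0_norm.
have int0 n : (\int[mu]_w (fn n (X w) * Z w)%:E = 0)%E.
  have E w : ((fn n (X w) * Z w)%:E =
      \sum_(y <- fset_set (range (fn n))) (y * (\1_(fn n @^-1` [set y]) (X w) * Z w))%:E)%E.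
    rewrite fimfunE fsbig_finite //= sumEFin mulr_suml; congr EFin.
    by apply: eq_bigr => y _; rewrite mulrA.
  under eq_integral do rewrite E.
  have mB y : measurable (fn n @^-1` [set y]) by exact: measurable_funPTI.
  have i1 y : rint (fun w => \1_(fn n @^-1` [set y]) (X w) * Z w).
    apply: (@rint_le _ (fun w => `|Z w|)); last exact: rint_abs.
      by apply: measurable_funM => //; apply: measurableT_comp => //; exact: measurable_indic.
    by move=> w; rewrite normrM indicE; case: (_ \in _); rewrite ?normr1 ?mul1r ?normr0 ?mul0r.
  rewrite integral_sum //; last by move=> y; apply: (rintZ y (i1 y)).
  apply: big1 => y _; under eq_integral do rewrite EFinM.
  rewrite integralZl //; last exact: i1.
  suff -> : (\int[mu]_w (\1_(fn n @^-1` [set y]) (X w) * Z w)%:E = 0)%E by rewrite mule0.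
  rewrite -(hZ _ (mB y)) [RHS]integral_mkcond; apply: eq_integral => w _.
  rewrite patchE indicE /=.
  have -> : (w \in X @^-1` (fn n @^-1` [set y])) = (X w \in fn n @^-1` [set y]).
    by apply/idP/idP => /set_mem h; exact: mem_set.
  by case: (X w \in _); rewrite ?mul1r ?mul0r.
have [] := @dominated_convergence _ T R mu setT measurableT
  (fun n w => (fn n (X w) * Z w)%:E) (fun w => (f (X w) * Z w)%:E) (fun w => `|f (X w) * Z w|%:E).
- by move=> n; apply/measurable_EFinP; exact: measurable_funM.
- by apply/measurable_EFinP; exact: rint_measurable ifZ.
- apply: aeW => w _; apply: cvg_EFin; first exact: nearW.
  by apply: cvgM; [exact: fncvg|exact: cvg_cst].
- exact: (rint_abs ifZ).
- by apply: aeW => w n _ /=; rewrite lee_fin !normrM ler_wpM2r // !ger0_norm.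
move=> _ _; under eq_fun do rewrite int0.
by move=> /cvg_lim; rewrite lim_cst // /Rintegral => <-.
Qed.

Lemma cond_integral0 d' (T' : measurableType d') (X : T -> T') Z (f : T' -> R) :
  measurable_fun setT X -> rint Z ->
  (forall B, measurable B -> (\int[mu]_(w in X @^-1` B) (Z w)%:E = 0)%E) ->
  measurable_fun setT f -> rint (fun w => f (X w) * Z w) ->
  \int[mu]_w (f (X w) * Z w) = 0.
Proof.
move=> mX iZ hZ mf ifZ.
pose fp x := Num.max (f x) 0; pose fm x := Num.max (- f x) 0.
have fpm x : f x = fp x - fm x.
  by rewrite /fp /fm; case: (leP (f x) 0) => h; case: (leP (- f x) 0) => h'; lra.
have mfp : measurable_fun setT fp by apply: measurable_maxr.
have mfm : measurable_fun setT fm by apply: measurable_maxr => //; exact: measurable_funN.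
have fp0 x : 0 <= fp x by rewrite le_max lexx orbT.
have fm0 x : 0 <= fm x by rewrite le_max lexx orbT.
have mZ := rint_measurable iZ.
have fpl x : `|fp x| <= `|f x|.
  by rewrite ger0_norm // /fp ge_max ler_norm normr_ge0.
have fml x : `|fm x| <= `|f x|.
  by rewrite ger0_norm // /fm ge_max -normrN ler_norm normr_ge0.
have ip : rint (fun w => fp (X w) * Z w).
  apply: rint_le (rint_abs ifZ); first by apply: measurable_funM => //; apply: measurableT_comp.
  by move=> w; rewrite !normrM ler_wpM2r.
have im : rint (fun w => fm (X w) * Z w).
  apply: rint_le (rint_abs ifZ); first by apply: measurable_funM => //; apply: measurableT_comp.
  by move=> w; rewrite !normrM ler_wpM2r.
under eq_Rintegral do rewrite fpm mulrBl.
by rewrite RintegralB // !(measurable_cond_integral0 mX iZ hZ) // subrr.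
Qed.

End RealIntegrable.

Section SquareIntegrable.
Context (dT : measure_display) (T : measurableType dT) (R : realType) (d : nat).
Variable mu : probability T R.
Implicit Types (Z : T -> 'rV[R]_d).

Lemma measurable_coord Z i : @measurable_fun _ _ T (Rd R d) setT Z ->
  measurable_fun setT (fun w => Z w 0 i).
Proof.
move=> mZ; apply: (@measurableT_comp _ _ _ _ _ _ (fun x : Rd R d => (x : 'rV[R]_d) 0 i)) => //.
by apply: continuous_measurable_real => x; exact: coord_continuous.
Qed.

Lemma L2vec_intro Z : @measurable_fun _ _ T (Rd R d) setT Z ->
  (forall i, rint mu (fun w => Z w 0 i ^+ 2)) -> L2vec mu Z.
Proof. by []. Qed.

Lemma L2vec_rintM Z Z' i j : L2vec mu Z -> L2vec mu Z' -> rint mu (fun w => Z w 0 i * Z' w 0 j).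
Proof.
move=> [mZ iZ] [mZ' iZ'].
apply: (@rint_le _ _ _ _ _ (fun w => Z w 0 i ^+ 2 + Z' w 0 j ^+ 2)).
- by apply: measurable_funM; exact: measurable_coord.
- move=> w; rewrite ler_norml; have := sqr_ge0 (Z w 0 i - Z' w 0 j).
  have := sqr_ge0 (Z w 0 i + Z' w 0 j); rewrite sqrrD sqrrB => h1 h2.
  have := sqr_ge0 (Z w 0 i); have := sqr_ge0 (Z' w 0 j); lra.
- by apply: rintD; [exact: iZ|exact: iZ'].
Qed.

Lemma L2vec_rint Z i : L2vec mu Z -> rint mu (fun w => Z w 0 i).
Proof.
move=> [mZ iZ]; apply: (@rint_le _ _ _ _ _ (fun w => Z w 0 i ^+ 2 + 1)).
- exact: measurable_coord.
- move=> w; rewrite ler_norml; have := sqr_ge0 (Z w 0 i - 1).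
  have := sqr_ge0 (Z w 0 i + 1); rewrite sqrrD sqrrB => h1 h2.
  have := sqr_ge0 (Z w 0 i); lra.
- by apply: rintD; [exact: iZ|exact: rint_cst].
Qed.

Lemma Sform_sum (S : 'M[R]_d) x y : Sform S x y = \sum_j \sum_i S i j * (x 0 i * y 0 j).
Proof.
rewrite /Sform mxE; apply: eq_bigr => j _; rewrite mxE mulr_suml.
by apply: eq_bigr => i _; rewrite mxE; ring.
Qed.

Lemma L2vec_rint_Sform (S : 'M[R]_d) Z Z' : L2vec mu Z -> L2vec mu Z' ->
  rint mu (fun w => Sform S (Z w) (Z' w)).
Proof.
move=> hZ hZ'; under eq_fun do rewrite Sform_sum.
by apply: rint_sum => j; apply: rint_sum => i; apply: rintZ; exact: L2vec_rintM.
Qed.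

Lemma L2vec_rint_qf (S : 'M[R]_d) Z : L2vec mu Z -> rint mu (fun w => qf S (Z w)).
Proof.
move=> hZ; rewrite /qf; under eq_fun do rewrite mulrC.
by apply: rintZ; exact: L2vec_rint_Sform.
Qed.

Lemma Rintegral_sum (I : finType) (h : I -> T -> R) : (forall i, rint mu (h i)) ->
  \int[mu]_w (\sum_i h i w) = \sum_i \int[mu]_w h i w.
Proof.
move=> hh; rewrite /Rintegral.
have -> : (\int[mu]_w (\sum_i h i w)%:E = \sum_i \int[mu]_w (h i w)%:E)%E.
  under eq_integral do rewrite -sumEFin.
  by rewrite integral_sum // => i; exact: hh.
by rewrite sum_fine // => i _; apply: integrable_fin_num => //; exact: hh.
Qed.

Lemma condexp_id_diff0 X Y i : L2vec mu X -> L2vec mu Y -> condexp_id mu X Y ->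
  forall B, measurable (B : set (Rd R d)) ->
  (\int[mu]_(w in X @^-1` B) (Y w 0 i - X w 0 i)%:E = 0)%E.
Proof.
move=> hX hY XY B mB; have mXB : measurable (X @^-1` B).
  by rewrite -[X in measurable X]setTI; exact: hX.1.
have iX : mu.-integrable (X @^-1` B) (fun w => (X w 0 i)%:E).
  by apply: integrableS (L2vec_rint i hX).
have iY : mu.-integrable (X @^-1` B) (fun w => (Y w 0 i)%:E).
  by apply: integrableS (L2vec_rint i hY).
rewrite (_ : (fun _ => _) = (fun w => (Y w 0 i)%:E - (X w 0 i)%:E)%E); last by [].
by rewrite integralB // XY // subee //; exact: integrable_fin_num.
Qed.

Lemma condexp_id_Sform0 (S : 'M[R]_d) X Y (f : Rd R d -> Rd R d) :
  L2vec mu X -> L2vec mu Y -> condexp_id mu X Y -> measurable_fun setT f ->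
  L2vec mu (fun w => f (X w)) ->
  \int[mu]_w Sform S (f (X w)) (Y w - X w) = 0.
Proof.
move=> hX hY XY mf hfX.
have iD i j : rint mu (fun w => (f (X w) : 'rV[R]_d) 0 i * (Y w 0 j - X w 0 j)).
  under eq_fun do rewrite mulrBr.
  by apply: rintB; apply: (@L2vec_rintM (fun w => f (X w))).
have iS i j : rint mu (fun w => S i j * ((f (X w) : 'rV[R]_d) 0 i * (Y w 0 j - X w 0 j))).
  exact: rintZ.
under eq_Rintegral.
  move=> w _; rewrite Sform_sum.
  under eq_bigr do under eq_bigr do rewrite [(Y w - X w) _ _]mxE [(- X w) _ _]mxE.
  over.
rewrite Rintegral_sum; last by move=> j; apply: rint_sum => i.
apply: big1 => j _; rewrite Rintegral_sum //; apply: big1 => i _.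
rewrite RintegralZl //; last exact: iD.
rewrite (cond_integral0 (f := fun x : Rd R d => (f x : 'rV[R]_d) 0 i) (Z := fun w => Y w 0 j - X w 0 j) hX.1) ?mulr0 //.
- by apply: rintB; exact: L2vec_rint.
- by move=> B mB; exact: condexp_id_diff0.
- apply: (@measurableT_comp _ _ _ _ _ _ (fun x : Rd R d => (x : 'rV[R]_d) 0 i)) => //.
  by apply: continuous_measurable_real => x; exact: coord_continuous.
Qed.
End SquareIntegrable.

(** * Weak duality for martingale couplings and its equality case *)

Section WeakDuality.
Variables (R : realType) (d : nat) (S A : 'M[R]_d) (e : 'rV[R]_d).
Hypothesis SA : sign_congruence S A e.
Variable G : set 'rV[R]_d.
Hypothesis mG : max_S_monotone S G.
Let K := A *m A^T.
Let symS : S^T = S := sign_congruence_sym SA.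

Lemma Knorm_le_of_Qf (pi : 'rV[R]_d -> 'rV[R]_d) z z' :
  qf K (pi z - pi z') <= 2 * qf K (z - z') ->
  Knorm A (pi z - pi z') <= 2 * Knorm A (z - z').
Proof.
move=> h; rewrite -[2 * _]ger0_norm ?mulr_ge0 ?Knorm_ge0 // -sqrtr_sqr ler_wsqrtr //.
by rewrite exprMn Knorm_sqr; have := Qf_ge0 A (z - z'); rewrite -/K; lra.
Qed.

Lemma Klipschitz_continuous (pi : 'rV[R]_d -> 'rV[R]_d) :
  (forall z z', qf K (pi z - pi z') <= 2 * qf K (z - z')) -> continuous pi.
Proof.
move=> lip; have [C C0 hC] := norm_le_Knorm SA.
suff cpi (z : 'rV[R]_d) : {for z, continuous pi} by move=> z; exact: cpi.
apply/(@cvgrPdist_le _ _ _ (nbhs z) _ pi (pi z)) => eps eps0.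
have cK : {for z, continuous (fun z' : 'rV[R]_d => Knorm A (z - z'))}.
  apply: (@continuous_comp _ _ _ (fun z' : 'rV[R]_d => z - z') (Knorm A)); last exact: Knorm_continuous.
  by apply: continuousB; [exact: cst_continuous|exact: cvg_id].
have e0 : 0 < eps / (C * 2) by rewrite divr_gt0 // mulr_gt0.
have /cvgrPdist_le /(_ _ e0) := cK.
have -> : Knorm A (z - z) = 0 by rewrite subrr /Knorm /qf Sform0l mul0r mulr0 sqrtr0.
move=> near_z; near=> z'.
have : `|0 - Knorm A (z - z')| <= eps / (C * 2) by near: z'.
rewrite sub0r normrN ger0_norm ?Knorm_ge0 // => h.
apply: le_trans (hC _) _; apply: le_trans (ler_wpM2l (ltW C0) (Knorm_le_of_Qf (lip z z'))) _.
by rewrite mulrA mulrC -ler_pdivlMr // mulr_gt0.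
Unshelve. all: by end_near. Qed.

Context (dT : measure_display) (T : measurableType dT) (mu : probability T R).

Lemma L2vec_Klipschitz (pi : 'rV[R]_d -> 'rV[R]_d) (X : T -> 'rV[R]_d) :
  (forall z z', qf K (pi z - pi z') <= 2 * qf K (z - z')) -> L2vec mu X ->
  L2vec mu (fun w => pi (X w)).
Proof.
move=> lip hX.
have mpi : @measurable_fun _ _ (Rd R d) (Rd R d) setT pi.
  by apply: continuous_measurable_row; exact: Klipschitz_continuous.
have mpX : @measurable_fun _ _ T (Rd R d) setT (fun w => pi (X w)).
  by apply: (@measurableT_comp _ _ _ _ (Rd R d) (Rd R d) pi) => //; exact: hX.1.
have [C C0 hC] := norm_le_Knorm SA.
apply: L2vec_intro => // i.
(* The square of a sum is at most twice the sum of the squares, and the squared K-norm of pi(X) -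
   pi(0) is at most 4 Q(X). *)
apply: (@rint_le _ _ _ _ _ (fun w => 8 * C ^+ 2 * qf K (X w) + 2 * `|pi 0| ^+ 2)).
- by apply: measurable_funX; exact: measurable_coord.
- move=> w; rewrite ger0_norm ?sqr_ge0 //.
  have h1 : `|pi (X w) 0 i| <= C * Knorm A (pi (X w) - pi 0) + `|pi 0|.
    rewrite (le_trans (coord_le_norm _ _)) // -[pi (X w)](subrK (pi 0)).
    by rewrite (le_trans (ler_normD _ _)) // lerD2r addrK.
  have h2 : Knorm A (pi (X w) - pi 0) ^+ 2 <= 4 * qf K (X w).
    by rewrite Knorm_sqr; have := lip (X w) 0; rewrite subr0 -/K; lra.
  have h3 : `|pi (X w) 0 i| ^+ 2 <= (C * Knorm A (pi (X w) - pi 0) + `|pi 0|) ^+ 2.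
    by rewrite lerXn2r // nnegrE // addr_ge0 // mulr_ge0 ?Knorm_ge0 // ltW.
  rewrite real_normK ?num_real // in h3; apply: le_trans h3 _.
  have h4 : C ^+ 2 * Knorm A (pi (X w) - pi 0) ^+ 2 <= C ^+ 2 * (4 * qf K (X w)).
    by rewrite ler_wpM2l ?sqr_ge0.
  have := sqr_ge0 (C * Knorm A (pi (X w) - pi 0) - `|pi 0|).
  by rewrite sqrrB exprMn => h5; rewrite sqrrD exprMn; lra.
- apply: rintD; last exact: rint_cst.
  by apply: rintZ; exact: L2vec_rint_qf.
Qed.

Variables X Y : T -> 'rV[R]_d.
Hypotheses (hX : L2vec mu X) (hY : L2vec mu Y) (XY : condexp_id mu X Y).

(** Since E[S(X, Y - X)] = 0, the primal objective depends on X alone. *)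
Lemma condexp_id_value : ((2^-1)%:E * \int[mu]_w (Sform S (X w) (Y w))%:E)%E =
  (\int[mu]_w qf S (X w))%:E.
Proof.
have := condexp_id_Sform0 S hX hY XY (f := fun x => x) (@measurable_id _ _ _) hX.
have iXY := L2vec_rint_Sform S hX hY; have iXX := L2vec_rint_Sform S hX hX.
under eq_Rintegral do rewrite SformDr SformNr.
rewrite RintegralB // => /eqP; rewrite subr_eq0 => /eqP E.
rewrite -[(\int[mu]_w (Sform S (X w) (Y w))%:E)%E]fineK; last first.
  by apply: integrable_fin_num => //; exact: iXY.
rewrite -EFinM; congr EFin; rewrite -/(Rintegral mu setT (fun w => Sform S (X w) (Y w))) E.
by rewrite -RintegralZl //; apply: eq_Rintegral => w _; rewrite /qf mulrC.
Qed.

Hypothesis ipsi : mu.-integrable setT (fun w => psi S G (Y w)).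

(** Pointwise, S(pi, Y) - q(pi) = q(X) - q(pi - X) + S(pi, Y - X) with pi taken at X. The last term
    has mean zero because pi is Lipschitz, which makes pi(X) square integrable. *)
Let projection_value : exists pi : 'rV[R]_d -> 'rV[R]_d,
  [/\ (forall z, G (pi z)) , (forall z, qf S (pi z - z) <= - qf K (pi z - z)),
      rint mu (fun w => Sform S (pi (X w)) (Y w) - qf S (pi (X w))),
      rint mu (fun w => qf S (pi (X w) - X w)) &
  \int[mu]_w (Sform S (pi (X w)) (Y w) - qf S (pi (X w))) =
    \int[mu]_w qf S (X w) - \int[mu]_w qf S (pi (X w) - X w)].
Proof.
have [pi [Gpi pineg lip]] := exists_minty_projection SA mG.
have hpi := L2vec_Klipschitz lip hX.
have iq := L2vec_rint_qf S hX; have ipY := L2vec_rint_Sform S hpi hY.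
have ipX := L2vec_rint_Sform S hpi hX; have iqp := L2vec_rint_qf S hpi.
have iD : rint mu (fun w => qf S (pi (X w) - X w)).
  under eq_fun do rewrite (qfB _ _ symS).
  by apply: rintB => //; apply: rintD.
exists pi; split => //; first exact: rintB.
have iS0 : rint mu (fun w => Sform S (pi (X w)) (Y w - X w)).
  by under eq_fun do rewrite SformDr SformNr; exact: rintB.
have mpi : @measurable_fun _ _ (Rd R d) (Rd R d) setT pi.
  by apply: continuous_measurable_row; exact: Klipschitz_continuous.
have S0 := condexp_id_Sform0 S hX hY XY mpi hpi.
rewrite -RintegralB // -[RHS]add0r -[X in _ = X + _]S0 -RintegralD //; last exact: rintB.
apply: eq_Rintegral => w _; rewrite (qfB _ _ symS) SformDr SformNr; ring.
Qed.

Lemma weak_duality : ((\int[mu]_w qf S (X w))%:E <= \int[mu]_w psi S G (Y w))%E.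
Proof.
have [pi [Gpi pineg iphi iD E]] := projection_value.
apply: (@le_trans _ _ (\int[mu]_w (Sform S (pi (X w)) (Y w) - qf S (pi (X w)))%:E)%E); last first.
  by apply: le_integral => // w _; exact: psi_ge.
rewrite -[leRHS]fineK ?integrable_fin_num // lee_fin.
rewrite -/(Rintegral mu setT (fun w => Sform S (pi (X w)) (Y w) - qf S (pi (X w)))) E lerBrDl -[leRHS]add0r lerD2r.
rewrite -oppr_ge0 -mulN1r -RintegralZl //; apply: Rintegral_ge0 => w _.
by have := pineg (X w); have := Qf_ge0 A (pi (X w) - X w); rewrite mulN1r -/K; lra.
Qed.

(** Equality annihilates the integrals of two nonnegative functions: the gap [h] between psi_G(Y)
    and the affine function at pi(X), and - q(pi(X) - X). The second gives pi(X) = X, after which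
    the first says that X is a maximizer. *)
Lemma weak_duality_eq : (\int[mu]_w psi S G (Y w) <= (\int[mu]_w qf S (X w))%:E)%E ->
  {ae mu, forall w, PG S G (Y w) (X w)}.
Proof.
move=> le; have [pi [Gpi pineg iphi iD E]] := projection_value.
have Dle w : qf S (pi (X w) - X w) <= 0.
  by have := pineg (X w); have := Qf_ge0 A (pi (X w) - X w); rewrite -/K; lra.
have mD := rint_measurable iD; have mphi := rint_measurable iphi.
pose h w := (psi S G (Y w) - (Sform S (pi (X w)) (Y w) - qf S (pi (X w)))%:E)%E.
have h0 w : (0 <= h w)%E by rewrite /h sube_ge0 ?psi_ge.
have mh : measurable_fun setT h.
  apply: emeasurable_funB; first by move/integrableP : ipsi => [].
  exact/measurable_EFinP.
have D'0 w : (0 <= (- qf S (pi (X w) - X w))%:E)%E by rewrite lee_fin oppr_ge0.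
have mD' : measurable_fun setT (fun w => (- qf S (pi (X w) - X w))%:E).
  by apply/measurable_EFinP; exact: measurable_funN.
have tot : (\int[mu]_w h w + \int[mu]_w (- qf S (pi (X w) - X w))%:E <= 0)%E.
  have -> : (\int[mu]_w (- qf S (pi (X w) - X w))%:E = (- \int[mu]_w qf S (pi (X w) - X w))%:E)%E.
    rewrite -mulN1r -RintegralZl // /Rintegral fineK; last by apply: integrable_fin_num => //; exact: rintZ.
    by apply: eq_integral => w _; rewrite mulN1r.
  rewrite /h integralB // -[X in (_ - X + _)%E]fineK ?integrable_fin_num //.
  rewrite -/(Rintegral mu setT (fun w => Sform S (pi (X w)) (Y w) - qf S (pi (X w)))) E.
  rewrite -EFinN -addeA -EFinD -leeBrDr // sub0e -EFinN.
  apply: le_trans le _; rewrite lee_fin; lra.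
have ih0 : (0 <= \int[mu]_w h w)%E by apply: integral_ge0.
have iD0 : (0 <= \int[mu]_w (- qf S (pi (X w) - X w))%:E)%E by apply: integral_ge0.
have hE : (\int[mu]_w h w = 0)%E.
  by apply/eqP; rewrite eq_le ih0 andbT; apply: le_trans tot; rewrite leeDl.
have DE : (\int[mu]_w (- qf S (pi (X w) - X w))%:E = 0)%E.
  by apply/eqP; rewrite eq_le iD0 andbT; apply: le_trans tot; rewrite leeDr.
have aeh : ae_eq mu setT h (cst 0%E).
  by apply/(ae_eq_integral_abs _ measurableT mh); rewrite -hE; apply: eq_integral => w _; rewrite gee0_abs.
have aeD : ae_eq mu setT (fun w => (- qf S (pi (X w) - X w))%:E) (cst 0%E).
  by apply/(ae_eq_integral_abs _ measurableT mD'); rewrite -DE; apply: eq_integral => w _; rewrite gee0_abs.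
apply: filterS2 aeh aeD => w /(_ I) hw /(_ I) /= [] Dw.
have piX : pi (X w) = X w.
  apply/eqP; rewrite -subr_eq0; apply/eqP; apply: (Qf_eq0 SA).
  by have := pineg (X w); rewrite -/K; lra.
apply/PGP; split; first by rewrite -piX; exact: Gpi.
move: hw; rewrite /h piX /=; case: (psi S G (Y w)) => [r| |] //= [].
by move/eqP; rewrite subr_eq0 => /eqP ->.
Qed.

End WeakDuality.

(** * First-order conditions for an optimal set *)

Section IntegralTools.
Context (dT : measure_display) (T : measurableType dT) (R : realType).
Variable mu : probability T R.

Lemma integrable_of_ge (f : T -> \bar R) (g : T -> R) : measurable_fun setT f ->
  rint mu g -> (forall w, ((g w)%:E <= f w)%E) -> (\int[mu]_w f w < +oo)%E ->
  mu.-integrable setT f.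
Proof.
move=> mf ig gf lt.
have mfp : measurable_fun setT f^\+%E by exact: measurable_funepos.
have mfn : measurable_fun setT f^\-%E by exact: measurable_funeneg.
have in_ : (\int[mu]_w f^\-%E w < +oo)%E.
  apply: le_lt_trans (_ : (\int[mu]_w `|g w|%:E < +oo)%E); last first.
    by apply: integrable_lty => //; exact: (rint_abs ig).
  apply: ge0_le_integral => //.
    by apply/measurable_EFinP; exact: (rint_measurable (rint_abs ig)).
  move=> w _; rewrite funenegE ge_max lee_fin normr_ge0 andbT leeNl -EFinN.
  by apply: le_trans (gf w); rewrite lee_fin; have := ler_norm (- g w); rewrite normrN; lra.
have ip : (\int[mu]_w f^\+%E w < +oo)%E.
  move: lt; rewrite integralE.
  have : (0 <= \int[mu]_w f^\-%E w)%E by apply: integral_ge0.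
  move: in_; case: (\int[mu]_w f^\-%E w)%E => // r _ _.
  by case: (\int[mu]_w f^\+%E w)%E => // s _; rewrite ltey.
apply/integrableP; split => //.
rewrite (_ : (fun w => `|f w|)%E = (fun w => f^\+ w + f^\- w)%E); last first.
  by rewrite -[LHS]/(abse \o f) fune_abse.
by rewrite ge0_integralD // lte_add_pinfty.
Qed.

(** Fatou's lemma with W <= liminf Zn expressed through the real levels r < W, the form in which the
    derivative bound supplies it. *)
Lemma fatou_le (Zn : nat -> T -> R) (W : T -> \bar R) (b : \bar R) :
  (forall n, measurable_fun setT (Zn n)) -> (forall n w, 0 <= Zn n w) ->
  measurable_fun setT W -> (forall w, (0 <= W w)%E) ->
  {ae mu, forall w, forall r : R, (r%:E < W w)%E ->
     exists N, forall n, (N <= n)%N -> r <= Zn n w} ->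
  (forall n, (\int[mu]_w (Zn n w)%:E <= b)%E) -> (\int[mu]_w W w <= b)%E.
Proof.
move=> mZ Z0 mW W0 hW hb.
pose U n w := (Zn n w)%:E.
have mU n : measurable_fun setT (U n) by exact/measurable_EFinP.
have ge_liminf w (r : R) N : (forall n, (N <= n)%N -> r <= Zn n w) -> (r%:E <= limn_einf (U^~ w))%E.
  move=> h; rewrite limn_einf_lim; apply: lime_ge; first exact: is_cvg_einfs.
  exists N => // n /= Nn; apply: le_ereal_inf_tmp => _ [m /= nm <-].
  by rewrite lee_fin; apply: h; exact: leq_trans nm.
have lim0 w : (0 <= limn_einf (U^~ w))%E by apply: (ge_liminf w 0 0%N).
apply: (@le_trans _ _ (\int[mu]_w limn_einf (U^~ w))%E).
  apply: ae_ge0_le_integral => //.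
    rewrite /limn_einf; apply: measurableT_comp => //.
    by apply: measurable_fun_limn_esup => n; apply: measurableT_comp.
  apply: filterS hW => w hw _; rewrite leNgt; apply/negP => LW.
  have [r rW Lr] : exists2 r : R, (r%:E < W w)%E & (limn_einf (U^~ w) < r%:E)%E.
    move: LW (lim0 w); case: (limn_einf (U^~ w)) => [s| |//]; last by rewrite ltNge leey.
    move=> + _; case: (W w) => // [r|].
      rewrite lte_fin => sr; exists ((s + r) / 2); rewrite lte_fin; lra.
    by move=> _; exists (s + 1); rewrite ?ltey // lte_fin ltrDl.
  have [N hN] := hw r rW.
  by move: Lr; rewrite ltNge (ge_liminf w r N).
have U0 n w : [set: T] w -> (0 <= U n w)%E by rewrite lee_fin.
apply: le_trans (fatou mu measurableT mU U0) _.
rewrite limn_einf_lim; apply: lime_le; first exact: is_cvg_einfs.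
by apply: nearW => n; apply: le_trans (hb n); apply: ereal_inf_lbound; exists n => //=.
Qed.

End IntegralTools.

(** Positive and negative parts are transported separately, so f need not be integrable. *)
Lemma measurable_integral_pushforward (d1 d2 : measure_display) (T1 : measurableType d1)
  (T2 : measurableType d2) (R : realType) (mu : probability T1 R) (phi : T1 -> T2)
  (f : T2 -> \bar R) : measurable_fun setT phi -> measurable_fun setT f ->
  (\int[pushforward mu phi]_y f y = \int[mu]_x f (phi x))%E.
Proof.
move=> mphi mf; rewrite integralE [RHS]integralE.
have mp := measurable_funepos mf; have mn := measurable_funeneg mf.
by congr (_ - _)%E; rewrite (ge0_integral_pushforward mphi) // preimage_setT;
  apply: eq_integral => w _; rewrite /= ?funeposE ?funenegE.
Qed.

Section Law.
Context (dO : measure_display) (O : measurableType dO) (R : realType) (d : nat).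
Variables (P : probability O R) (Y : O -> 'rV[R]_d).
Hypothesis mY : @measurable_fun _ _ O (Rd R d) setT Y.

Lemma integral_law (f : Rd R d -> \bar R) : measurable_fun setT f ->
  (\int[law P Y]_y f y = \int[P]_w f (Y w))%E.
Proof. exact: (measurable_integral_pushforward P mY). Qed.

Lemma law_negligible_ae (N : set (Rd R d)) : (law P Y).-negligible N ->
  {ae P, forall w, ~ N (Y w)}.
Proof.
move=> [B [mB PB NB]]; exists (Y @^-1` B); split.
- by rewrite -[X in measurable X]setTI; exact: mY.
- exact: PB.
- by move=> w /= /contrapT /NB.
Qed.

End Law.

Section DualOptimal.
Variables (R : realType) (d : nat) (S A : 'M[R]_d) (e : 'rV[R]_d).
Hypothesis SA : sign_congruence S A e.
Let K := A *m A^T.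
Context (dO : measure_display) (O : measurableType dO) (P : probability O R).
Variables (Y : O -> 'rV[R]_d) (G : set 'rV[R]_d).
Hypotheses (hY : L2vec P Y) (hG : dual_optimal P S Y G).

Let mG : max_S_monotone S G := hG.1.

Lemma measurable_psi_comp (H : set 'rV[R]_d) : measurable_fun setT (fun w => psi S H (Y w)).
Proof.
apply: (@measurableT_comp _ _ _ _ (Rd R d) _ (psi S H)); last exact: hY.1.
exact: psi_measurable.
Qed.

Lemma dual_optimal_le (H : set 'rV[R]_d) : max_S_monotone S H ->
  (\int[P]_w psi S G (Y w) <= \int[P]_w psi S H (Y w))%E.
Proof. by move=> /(hG.2); rewrite !(integral_law P hY.1) //; exact: psi_measurable. Qed.

(** The integrable q(Y) bounds it from below, and the competitor lying under Q bounds its integral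
    from above. *)
Lemma dual_optimal_integrable : P.-integrable setT (fun w => psi S G (Y w)).
Proof.
apply: (@integrable_of_ge _ _ _ _ _ (fun w => qf S (Y w))).
- exact: measurable_psi_comp.
- exact: L2vec_rint_qf.
- by move=> w; exact: (max_S_monotone_psi_ge SA mG).
have [H mH psiQ] := exists_psi_le_Qf SA.
apply: le_lt_trans (dual_optimal_le mH) _.
apply: integrable_lty => //.
have ib : rint P (fun w => `|qf S (Y w)| + qf K (Y w)).
  by apply: rintD; [apply: rint_abs|]; exact: L2vec_rint_qf.
apply: le_integrable ib => //; first exact: measurable_psi_comp.
move=> w _ /=; have := psiQ (Y w); have := max_S_monotone_psi_ge SA mH (Y w).
case: (psi S H (Y w)) => // r; rewrite /abse !lee_fin -/K => h1 h2.
rewrite [leRHS]ger0_norm ?addr_ge0 ?Qf_ge0 // ler_norml.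
have := ler_norm (- qf S (Y w)); have := Qf_ge0 A (Y w); have := normr_ge0 (qf S (Y w)).
by rewrite normrN -/K; lra.
Qed.

End DualOptimal.

(** * The variational inequality for coercive fields *)

Section VariationInequality.
Variables (R : realType) (d : nat) (S A : 'M[R]_d) (e : 'rV[R]_d).
Hypothesis SA : sign_congruence S A e.
Let K := A *m A^T.
Context (dO : measure_display) (O : measurableType dO) (P : probability O R).
Variables (Y : O -> 'rV[R]_d) (G : set 'rV[R]_d).
Hypotheses (hY : L2vec P Y) (hG : dual_optimal P S Y G).
Hypothesis hSigma : (law P Y).-negligible (SigmaP S G : set (Rd R d)).

Let mG : max_S_monotone S G := hG.1.
Let X w := PGmap S G (Y w).

Let psiNy y : psi S G y != -oo%E.
Proof. by have := max_S_monotone_psi_ge SA mG y; case: (psi S G y). Qed.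

Lemma PGmap_comp_measurable : @measurable_fun _ _ O (Rd R d) setT X.
Proof.
apply: (@measurableT_comp _ _ _ _ (Rd R d) (Rd R d) (PGmap S G)); last exact: hY.1.
exact: (PGmap_measurable (max_S_monotone_closed mG) psiNy).
Qed.

Lemma PG_nonempty_measurable : measurable [set w | PG S G (Y w) !=set0].
Proof.
have m0 := PG_closed_measurable (max_S_monotone_closed mG) psiNy (@closedT _).
rewrite (_ : [set w | _] = setT `&` Y @^-1` [set y | PG S G y `&` setT !=set0]).
  exact: hY.1.
by rewrite setTI; apply/seteqP; split => w /=; rewrite setIT.
Qed.

Lemma PGmap_mem y : ~ SigmaP S G y -> PG S G y !=set0 -> PG S G y = [set PGmap S G y].
Proof.
move=> nS n0; have [x Px] : exists x, PG S G y = [set x] by apply: contrapT => h; apply: nS.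
rewrite /PGmap; case: asboolP => // _.
by rewrite Px (@xget_unique _ _ _ x).
Qed.

Lemma measurable_Sform (Z1 Z2 : O -> 'rV[R]_d) : @measurable_fun _ _ O (Rd R d) setT Z1 ->
  @measurable_fun _ _ O (Rd R d) setT Z2 -> measurable_fun setT (fun w => Sform S (Z1 w) (Z2 w)).
Proof.
move=> m1 m2; under eq_fun do rewrite Sform_sum.
apply: measurable_sum => j; apply: measurable_sum => i; apply: measurable_funM => //.
by apply: measurable_funM; exact: measurable_coord.
Qed.

Variables (k : 'rV[R]_d -> 'rV[R]_d) (C : R) (M : 'rV[R]_d -> R) (c : R).
Hypotheses (kcont : continuous k) (kC : forall x, qf K (k x) <= C) (c0 : 0 < c).
Hypothesis kcoercive : forall x y, Sform S (k x) (y - x) <= M y - c * Knorm A x.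
Hypothesis iM : rint P (fun w => M (Y w)).

Let Lam w := Sform S (k (X w)) (Y w - X w).
(** An integrable upper bound of all difference quotients of the dual integrand; subtracting the
    quotients from it produces the nonnegative functions for Fatou's lemma. *)
Let g w := `|M (Y w)| + C.

Let kM x y : Sform S (k x) (y - x) <= M y.
Proof.
apply: le_trans (kcoercive x y) _; rewrite lerBlDr lerDl.
by rewrite mulr_ge0 ?Knorm_ge0 // ltW.
Qed.

Let C0 : 0 <= C. Proof. exact: (le_trans (Qf_ge0 A _) (kC 0)). Qed.

Let mLam : measurable_fun setT Lam.
Proof.
have mkX : @measurable_fun _ _ O (Rd R d) setT (fun w => k (X w)).
  apply: (@measurableT_comp _ _ _ _ (Rd R d) (Rd R d) k); last exact: PGmap_comp_measurable.
  exact: continuous_measurable_row.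
rewrite /Lam; under eq_fun do rewrite SformDr SformNr.
apply: measurable_funB; apply: measurable_Sform => //; [exact: hY.1|exact: PGmap_comp_measurable].
Qed.

Let ig : rint P g.
Proof. by apply: rintD; [exact: rint_abs|exact: rint_cst]. Qed.

Let psi_fin : {ae P, forall w, psi S G (Y w) \is a fin_num}.
Proof.
have := integrable_ae measurableT (dual_optimal_integrable SA hY hG).
by apply: filterS => w; apply.
Qed.

Let t n : R := n.+1%:R^-1.
Let t0 n : 0 < t n. Proof. by rewrite invr_gt0. Qed.
Let t1 n : t n <= 1. Proof. by rewrite invf_le1 // ler1n. Qed.

Let competitors : exists H : nat -> set 'rV[R]_d, forall n, max_S_monotone S (H n) /\
  forall y (a : R),
    (forall x, G x -> Sform S x y - qf S x + t n * Sform S (k x) (y - x) <= a) ->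
    (psi S (H n) y <= (a + t n ^+ 2 * C)%:E)%E.
Proof.
have /choice[H hH] : forall n, exists H, max_S_monotone S H /\ forall y (a : R),
    (forall x, G x -> Sform S x y - qf S x + t n * Sform S (k x) (y - x) <= a) ->
    (psi S H y <= (a + t n ^+ 2 * C)%:E)%E.
  move=> n; have [H mH h] := exists_psi_variation SA mG kC kM (ltW (t0 n)).
  by exists H.
by exists H.
Qed.

(** Optimality of G bounds the integral of [Z n], which is [g] minus the difference quotient, by
    that of [g]. The lower limit of [Z n] is at least [g - Lam] where a maximizer exists and +oo
    elsewhere. Fatou's lemma, with +oo replaced by a number m added to [g - Lam], bounds m times the
    probability of having no maximizer by E[Lam], for every m. *)
Lemma variation_inequality : [/\ {ae P, forall w, PG S G (Y w) !=set0}, rint P Lam &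
  0 <= \int[P]_w Lam w].
Proof.
have [H hH] := competitors.
pose p w := fine (psi S G (Y w)).
pose D := [set w | psi S G (Y w) \is a fin_num].
(* On the null complement of [D] both [p] and [q_ n] are 0, so the estimates hold at every w. *)
pose q_ n w := \1_D w * fine (psi S (H n) (Y w)).
have mD : measurable D.
  by have := emeasurable_fin_num measurableT (measurable_psi_comp S hY G); rewrite setTI.
have mp : measurable_fun setT p by apply: measurableT_comp => //; exact: (measurable_psi_comp _ hY).
have mq n : measurable_fun setT (q_ n).
  apply: measurable_funM; first exact: measurable_indic.
  by apply: measurableT_comp => //; exact: (measurable_psi_comp _ hY).
have inD w : D w -> \1_D w = 1 :> R by move=> Dw; rewrite indicE mem_set.
have notD w : ~ D w -> \1_D w = 0 :> R by move=> Dw; rewrite indicE memNset.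
have hphi w x : D w -> G x -> Sform S x (Y w) - qf S x <= p w.
  by move=> Dw Gx; rewrite -lee_fin fineK //; exact: psi_ge.
have qle n w L : D w -> (forall x, G x ->
    Sform S x (Y w) - qf S x + t n * Sform S (k x) (Y w - x) <= p w + t n * L) ->
    psi S (H n) (Y w) \is a fin_num /\ q_ n w <= p w + t n * L + t n ^+ 2 * C.
  move=> Dw h; have h1 := (hH n).2 (Y w) _ h; have h2 := max_S_monotone_psi_ge SA (hH n).1 (Y w).
  have fin : psi S (H n) (Y w) \is a fin_num by move: h1 h2; case: (psi S (H n) (Y w)).
  by split => //; rewrite /q_ inD // mul1r -lee_fin fineK.
have qM n w : D w -> psi S (H n) (Y w) \is a fin_num /\
    q_ n w <= p w + t n * M (Y w) + t n ^+ 2 * C.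
  by move=> Dw; apply: qle => // x Gx; apply: lerD; [exact: hphi|rewrite ler_wpM2l // ltW].
have qge n w : D w -> qf S (Y w) <= q_ n w.
  move=> Dw; rewrite /q_ inD // mul1r -lee_fin fineK; last exact: (qM n w Dw).1.
  exact: (max_S_monotone_psi_ge SA (hH n).1).
have pN w : ~ D w -> p w = 0.
  by move=> /negP; rewrite /p; case: (psi S G (Y w)).
have t2 n : t n ^+ 2 <= t n by rewrite expr2 ler_piMr // ltW.
have ip : rint P p.
  apply: le_integrable (dual_optimal_integrable SA hY hG) => //; first exact/measurable_EFinP.
  by move=> w _ /=; rewrite /p; case: (psi S G (Y w)) => [r| |] //=; rewrite normr0 ?leey.
have iq n : rint P (q_ n).
  apply: (@rint_le _ _ _ _ _ (fun w => `|qf S (Y w)| + (`|p w| + (`|M (Y w)| + C)))).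
  - exact: mq.
  - move=> w; have [Dw|Dw] := pselect (D w); last first.
      by rewrite /q_ notD // mul0r normr0 !addr_ge0.
    have := qge n w Dw; have := (qM n w Dw).2.
    have hM : t n * M (Y w) <= `|M (Y w)|.
      apply: le_trans (ler_wpM2l (ltW (t0 n)) (ler_norm _)) _.
      by rewrite ler_piMl.
    have hC : t n ^+ 2 * C <= C by rewrite ler_piMl // (le_trans (t2 n)).
    have := ler_norm (- qf S (Y w)); have := normr_ge0 (qf S (Y w)); rewrite normrN.
    have := ler_norm (p w); have := normr_ge0 (p w); have := normr_ge0 (M (Y w)).
    rewrite ler_norml; move: C0; lra.
  - apply: rintD; first by apply: rint_abs; exact: L2vec_rint_qf.
    by apply: rintD => //; exact: rint_abs.
have pq n : \int[P]_w p w <= \int[P]_w q_ n w.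
  rewrite -lee_fin /Rintegral !fineK; try by apply: integrable_fin_num => //; first [exact: ip|exact: (iq n)].
  have -> : (\int[P]_w (p w)%:E = \int[P]_w psi S G (Y w))%E.
    apply: ae_eq_integral => //; [exact/measurable_EFinP|exact: (measurable_psi_comp _ hY)|].
    by apply: filterS psi_fin => w Dw _; rewrite fineK.
  have -> : (\int[P]_w (q_ n w)%:E = \int[P]_w psi S (H n) (Y w))%E.
    apply: ae_eq_integral => //; [exact/measurable_EFinP|exact: (measurable_psi_comp _ hY)|].
    by apply: filterS psi_fin => w Dw _; rewrite /q_ inD // mul1r fineK //; exact: (qM n w Dw).1.
  exact: (dual_optimal_le hY hG (hH n).1).
pose Z n w := g w + n.+1%:R * (p w - q_ n w).
have tn n : n.+1%:R * t n = 1 by rewrite /t mulfV.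
have Zge n w L : D w -> q_ n w <= p w + t n * L + t n ^+ 2 * C -> g w - L - t n * C <= Z n w.
  move=> Dw h; have : n.+1%:R * q_ n w <= n.+1%:R * (p w + t n * L + t n ^+ 2 * C) by rewrite ler_wpM2l.
  have -> : n.+1%:R * (p w + t n * L + t n ^+ 2 * C) = n.+1%:R * p w + L + t n * C.
    by rewrite expr2 !mulrDr !mulrA tn !mul1r.
  by rewrite /Z mulrBr; lra.
have Z0 n w : 0 <= Z n w.
  have [Dw|Dw] := pselect (D w); last first.
    by rewrite /Z pN // /q_ notD // mul0r subr0 mulr0 addr0 addr_ge0.
  apply: le_trans (Zge _ _ _ Dw (qM n w Dw).2).
  have := ler_norm (M (Y w)); have : t n * C <= C by rewrite ler_piMl.
  by rewrite /g; lra.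
have iZ n : rint P (Z n) by apply: rintD => //; apply: rintZ; exact: rintB.
have intZ n : (\int[P]_w (Z n w)%:E <= (\int[P]_w g w)%:E)%E.
  have ZE : \int[P]_w Z n w = \int[P]_w g w + n.+1%:R * (\int[P]_w p w - \int[P]_w q_ n w).
    rewrite /Z RintegralD //; last by apply: rintZ; exact: rintB.
    rewrite RintegralZl //; last exact: (rintB ip (iq n)).
    by rewrite RintegralB //; exact: iq.
  rewrite -[leLHS]fineK; last by apply: integrable_fin_num => //; exact: (iZ n).
  rewrite lee_fin -[leLHS]/(\int[P]_w Z n w) ZE gerDl pmulr_rle0 // subr_le0; exact: pq.
pose N := [set w | PG S G (Y w) !=set0].
have mN : measurable N by exact: PG_nonempty_measurable.
(* The number m stands in for +oo on the event that there is no maximizer. *)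
pose W (m : nat) w := g w - Lam w + m%:R * \1_(~` N) w.
have LamM w : Lam w <= M (Y w) by exact: kM.
have gL w : 0 <= g w - Lam w.
  by have := LamM w; have := ler_norm (M (Y w)); rewrite /g; move: C0; lra.
have mW m : measurable_fun setT (W m).
  apply: measurable_funD; first by apply: measurable_funB => //; exact: (rint_measurable ig).
  by apply: measurable_funM => //; apply: measurable_indic; exact: measurableC.
have W0 m w : 0 <= W m w by rewrite addr_ge0 // mulr_ge0 // indicE.
have fat m : (\int[P]_w (W m w)%:E <= (\int[P]_w g w)%:E)%E.
  apply: (@fatou_le _ _ _ P Z) => //.
  - by move=> n; exact: (rint_measurable (iZ n)).
  - exact/measurable_EFinP.
  - by move=> w; rewrite lee_fin.
  apply: filterS2 psi_fin (law_negligible_ae hY.1 hSigma) => w Dw nS r.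
  rewrite lte_fin => rW.
  (* Where a maximizer exists, this is the midpoint of [Lam w] and [g w - r]. The margin
     [(W m w - r) / 2] pays for the error [t n * C], which is why it enters [s']. *)
  pose L := g w - r - (W m w - r) / 2.
  have hL x : PG S G (Y w) x -> Sform S (k x) (Y w - x) < L.
    move=> Px; have Nw : N w by exists x.
    move: (Px); rewrite (PGmap_mem nS Nw) /= => xE.
    have -> : Sform S (k x) (Y w - x) = Lam w by rewrite /Lam /X xE.
    move: rW; rewrite /L /W indicE memNset; last by move=> /(_ Nw).
    rewrite mulr0 addr0; lra.
  have [s s0 hs] := variation_derivative_le SA mG kM c0 kcoercive kcont Dw hL.
  pose s' := Num.min s ((W m w - r) / 2 / (C + 1)).
  have s'0 : 0 < s'.
    rewrite lt_min s0 /= divr_gt0 // ?divr_gt0 ?subr_gt0 //; move: C0; lra.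
  exists (Num.truncn (s'^-1)).+1 => n Nn.
  have ts' : t n <= s'.
    rewrite /t -[leRHS]invrK lef_pV2 ?posrE ?invr_gt0 //.
    apply: ltW; apply: lt_le_trans (truncnS_gt _) _; rewrite ler_nat; exact: leqW.
  have ts : t n <= s by apply: le_trans ts' _; rewrite ge_min lexx.
  have tC : t n * C <= (W m w - r) / 2.
    have : t n <= (W m w - r) / 2 / (C + 1) by apply: le_trans ts' _; rewrite ge_min lexx orbT.
    rewrite ler_pdivlMr; last by move: C0; lra.
    by rewrite mulrDr mulr1; have := t0 n; lra.
  have := qle n w L Dw (hs (t n) _); have -> : 0 <= t n <= s by rewrite ltW.
  move=> /(_ isT) [_] /(Zge _ _ _ Dw); rewrite /L; lra.
have iGL : rint P (fun w => g w - Lam w).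
  apply/integrableP; split; first by apply/measurable_EFinP; apply: measurable_funB => //; exact: (rint_measurable ig).
  apply: le_lt_trans (_ : ((\int[P]_w g w)%:E < +oo)%E); last by rewrite ltey.
  apply: le_trans (fat 0%N); rewrite le_eqVlt; apply/orP; left; apply/eqP; apply: eq_integral => w _ /=.
  by rewrite /W mul0r addr0 ger0_norm.
have iL : rint P Lam.
  have -> : Lam = (fun w => g w - (g w - Lam w)) by apply/funext => w; rewrite subKr.
  exact: rintB.
have iI : rint P (\1_(~` N)).
  apply: (@rint_le _ _ _ _ _ (fun=> 1)); last exact: rint_cst.
    by apply: measurable_indic; exact: measurableC.
  by move=> w; rewrite indicE; case: (_ \in _); rewrite ?normr1 ?normr0.
have key (m : nat) : m%:R * fine (P (~` N)) <= \int[P]_w Lam w.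
  have := fat m; rewrite -[leLHS]fineK; last first.
    apply: integrable_fin_num => //; apply: rintD => //; exact: rintZ.
  rewrite lee_fin -/(Rintegral P setT (W m)) /W RintegralD //; last exact: rintZ.
  rewrite RintegralB // RintegralZl //.
  have -> : \int[P]_w \1_(~` N) w = fine (P (~` N)).
    by rewrite /Rintegral integral_indic //= ?setIT //; exact: measurableC.
  lra.
split => //; last by have := key 0%N; rewrite mul0r.
have PN0 : fine (P (~` N)) = 0.
  apply/eqP; rewrite eq_le fine_ge0 ?andbT; last exact: measure_ge0.
  rewrite leNgt; apply/negP => pos.
  have := key (Num.truncn (\int[P]_w Lam w / fine (P (~` N)))).+1.
  by rewrite -ler_pdivlMr // leNgt truncnS_gt.
exists (~` N); split => //; first exact: measurableC.
have fPN : P (~` N) \is a fin_num by apply: fin_num_measure; exact: measurableC.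
by rewrite -(fineK fPN) PN0.
Qed.

End VariationInequality.

(** * Cutoff functions and test fields *)

Section OpenCutoff.
Variables (R : realType) (d : nat) (U : set 'rV[R]_d).
Hypothesis oU : open U.

(** The distance to the complement of U, cut off at 1; the extra element 1 keeps the infimum
    meaningful when U is the whole space. *)
Definition codist (x : 'rV[R]_d) : R :=
  inf ([set Num.min 1 `|x - z| | z in ~` U] `|` [set 1]).

Let V x := [set Num.min 1 `|x - z| | z in ~` U] `|` [set 1].

Let V_lb x : lbound (V x) 0.
Proof. by move=> _ [[z _ <-]|->]; rewrite ?le_min ?normr_ge0 ?ler01. Qed.

Let V_inf x : has_inf (V x).
Proof. by split; [exists 1; right|exists 0; exact: V_lb]. Qed.

Lemma codist_ge0 x : 0 <= codist x.
Proof. by apply: lb_le_inf; [exact: (V_inf x).1|exact: V_lb]. Qed.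

Lemma codist_out x : ~ U x -> codist x = 0.
Proof.
move=> nU; apply/eqP; rewrite eq_le codist_ge0 andbT; apply: ge_inf; first exact: (V_inf x).2.
by left; exists x => //; rewrite subrr normr0 min_r // ler01.
Qed.

Lemma codist_in x : U x -> 0 < codist x.
Proof.
move=> Ux; have /nbhs_ballP [r /= r0 hr] : nbhs x U by exact: open_nbhs_nbhs.
have m0 : 0 < Num.min 1 r by rewrite lt_min ltr01.
apply: lt_le_trans m0 _; apply: lb_le_inf; first exact: (V_inf x).1.
move=> _ [[z nUz <-]|->]; last by rewrite ge_min lexx.
rewrite le_min ge_min lexx /= ge_min; apply/orP; right; rewrite leNgt; apply/negP => h.
by apply: nUz; apply: hr; rewrite -ball_normE.
Qed.

Let codist_le x y : codist x <= codist y + `|x - y|.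
Proof.
rewrite -lerBlDr; apply: lb_le_inf; first exact: (V_inf y).1.
move=> _ [[z nUz <-]|->]; rewrite lerBlDr; last first.
  apply: (@le_trans _ _ 1); last by rewrite lerDl.
  by apply: ge_inf; [exact: (V_inf x).2|right].
apply: (@le_trans _ _ (Num.min 1 `|x - z|)).
  by apply: ge_inf; [exact: (V_inf x).2|left; exists z].
have tri : `|x - z| <= `|y - z| + `|x - y|.
  by have := ler_normD (x - y) (y - z); rewrite addrA subrK (addrC `|x - y|).
have := normr_ge0 (x - y); rewrite !minEle.
by case: ifP => h1; case: ifP => h2; move: h1 h2 => /negP h1 /negP h2; lra.
Qed.

Lemma codist_continuous : continuous codist.
Proof.
suff cd (x : 'rV[R]_d) : {for x, continuous codist} by move=> x; exact: cd.
apply/(@cvgrPdist_le _ _ _ (nbhs x) _ codist (codist x)) => eps eps0.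
near=> y; have xy : `|x - y| <= eps by near: y; apply: cvgr_dist_le => //; exact: cvg_id.
rewrite ler_norml; have := codist_le x y; have := codist_le y x.
by rewrite (distrC y x); lra.
Unshelve. all: by end_near. Qed.

End OpenCutoff.

Section TestFields.
Variables (R : realType) (d : nat) (S A : 'M[R]_d) (e : 'rV[R]_d).
Hypothesis SA : sign_congruence S A e.
Let K := A *m A^T.

(* Pushes the points of G towards the origin: the derivative of the dual value in this
   direction is -oo wherever a maximizing sequence of psi_G escapes to infinity. *)
Definition inward_field x := (1 + Knorm A x)^-1 *: (x *m Jmx A e).

Let N1 x : 0 < 1 + Knorm A x.
Proof. by rewrite ltr_pwDl // Knorm_ge0. Qed.

Lemma inward_field_continuous : continuous inward_field.
Proof.
suff cd (x : 'rV[R]_d) : {for x, continuous inward_field} by move=> x; exact: cd.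
apply: (@continuousZ _ _ _ (fun x => (1 + Knorm A x)^-1) (fun x => x *m Jmx A e)).
  have cN : {for x, continuous (fun x => 1 + Knorm A x)}.
    by apply: continuousD; [exact: cst_continuous|exact: Knorm_continuous].
  by apply: continuousV => //; rewrite gt_eqF.
apply: (Klipschitz_continuous SA) => z z'; rewrite -mulmxBl (Qf_J SA) -/K.
by have := Qf_ge0 A (z - z'); rewrite -/K; lra.
Qed.

Lemma inward_field_bounded x : qf K (inward_field x) <= 1 / 2.
Proof.
rewrite /inward_field qfZ (Qf_J SA) exprVn mulrC ler_pdivrMr ?exprn_gt0 //.
by have := Knorm_sqr A x; have := Knorm_ge0 A x; rewrite -/K sqrrD; lra.
Qed.

(** S(x J, y - x) = K(x, y) - |x|^2 <= |x| |y| - |x|^2 in the K-norm, and this is at most (1 + |x|)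
    (|y| + 1 - |x|). *)
Lemma inward_field_coercive x y :
  Sform S (inward_field x) (y - x) <= Knorm A y + 1 - Knorm A x.
Proof.
rewrite /inward_field SformZl (Sform_J SA) mulrC ler_pdivrMr // SformDr SformNr.
have := Kform_le_Knorm SA x y; have := Knorm_sqr A x; have := Knorm_ge0 A x; have := Knorm_ge0 A y.
rewrite /qf -/K; nra.
Qed.

Let v i : 'rV[R]_d := delta_mx 0 i *m invmx S.

Lemma Sform_dual_basis i y : Sform S (v i) y = y 0 i.
Proof.
have Su : S \in unitmx.
  have [Au -> e1] := SA; rewrite !unitmx_mul Au unitmx_tr Au andbT unitmxE det_diag unitfE.
  apply/prodf_neq0 => j _; apply/eqP => ej; have := e1 j.
  by rewrite ej expr2 mulr0 => /eqP; rewrite eq_sym oner_eq0.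
by rewrite /Sform /v mulmxKV // -rowE !mxE.
Qed.

Context (dO : measure_display) (O : measurableType dO) (P : probability O R).
Variables (Y : O -> 'rV[R]_d) (G : set 'rV[R]_d).
Hypotheses (hY : L2vec P Y) (hG : dual_optimal P S Y G).
Hypothesis hSigma : (law P Y).-negligible (SigmaP S G : set (Rd R d)).
Let X w := PGmap S G (Y w).
Let kap w := Sform S (inward_field (X w)) (Y w - X w).

Let rint_Knorm (Z : O -> 'rV[R]_d) : L2vec P Z -> rint P (fun w => Knorm A (Z w)).
Proof.
move=> hZ; apply: (@rint_le _ _ _ _ _ (fun w => 1 + 2 * qf K (Z w))).
- apply: (@measurableT_comp _ _ _ _ (Rd R d) _ (Knorm A)); last exact: hZ.1.
  by apply: continuous_measurable_real; exact: Knorm_continuous.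
- move=> w; rewrite ger0_norm ?Knorm_ge0 // -Knorm_sqr.
  by have := sqr_ge0 (Knorm A (Z w) - 1); have := sqr_ge0 (Knorm A (Z w)); rewrite sqrrB; lra.
- by apply: rintD; [exact: rint_cst|apply: rintZ; exact: L2vec_rint_qf].
Qed.

(** The field [eta x *: u] vanishes far out and has no coercivity of its own; the multiple of
    [inward_field] supplies it. *)
Let test_inequality (eta : 'rV[R]_d -> R) (B r del : R) u : continuous eta ->
  0 <= B -> 0 <= r -> 0 < del -> (forall x, `|eta x| <= B) -> (forall x, r < Knorm A x -> eta x = 0) ->
  let L w := eta (X w) * Sform S u (Y w - X w) + del * kap w in
  [/\ {ae P, forall w, PG S G (Y w) !=set0}, rint P L & 0 <= \int[P]_w L w].
Proof.
move=> ceta B0 r0 del0 etaB etar L.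
pose k x := eta x *: u + del *: inward_field x.
have kS x y : Sform S (k x) (y - x) = eta x * Sform S u (y - x) + del * Sform S (inward_field x) (y - x).
  by rewrite /k SformDl !SformZl.
have -> : L = (fun w => Sform S (k (X w)) (Y w - X w)) by apply/funext => w; rewrite kS.
apply: (@variation_inequality _ _ _ _ _ SA _ _ _ _ _ hY hG hSigma k
   (* The bounds come from Q(a + b) <= 2 Q(a) + 2 Q(b), with Q at most 1/2 on the inward field, and
      from |S(u, y - x)| <= 2 Q(u) + Q(y) + Q(x), with Q(x) <= r^2 / 2 wherever [eta] may be
      nonzero. *)
   (2 * (B ^+ 2 * qf K u) + del ^+ 2)
   (fun y => B * (2 * qf K u + qf K y + r ^+ 2 / 2) + del * (Knorm A y + 1)) del) => //.
- suff ck (x : 'rV[R]_d) : {for x, continuous k} by move=> x; exact: ck.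
  apply: (@continuousD _ _ _ (fun x => eta x *: u) (fun x => del *: inward_field x)).
    by apply: (@continuousZ _ _ _ eta (fun=> u)); [exact: ceta|exact: cst_continuous].
  apply: (@continuousZ _ _ _ (fun=> del) inward_field); first exact: cst_continuous.
  exact: inward_field_continuous.
- move=> x; rewrite /k.
  have h1 : qf K (eta x *: u) <= B ^+ 2 * qf K u.
    rewrite qfZ ler_wpM2r ?Qf_ge0 // -[eta x ^+ 2]real_normK ?num_real //.
    by rewrite lerXn2r // nnegrE.
  have h2 : qf K (del *: inward_field x) <= del ^+ 2 * (1 / 2).
    by rewrite qfZ ler_wpM2l ?sqr_ge0 // inward_field_bounded.
  have := Qf_ge0 A (eta x *: u - del *: inward_field x).
  rewrite (qfB _ _ (mulmx_trmx_sym A)) (qfD _ _ (mulmx_trmx_sym A)) -/K; lra.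
- move=> x y; rewrite kS -addrA -mulrBr; apply: lerD; last first.
    by apply: ler_wpM2l; [exact: ltW|exact: inward_field_coercive].
  have Qu := Qf_ge0 A u; have Qy := Qf_ge0 A y; rewrite -/K in Qu Qy.
  have [xr|xr] := ltP r (Knorm A x).
    by rewrite etar // mul0r mulr_ge0 //; have := sqr_ge0 r; lra.
  apply: le_trans (ler_norm _) _; rewrite normrM; apply: ler_pM => //.
  have Qx : 2 * qf K x <= r ^+ 2 by rewrite -Knorm_sqr lerXn2r // nnegrE Knorm_ge0.
  have := Sform_le_Qf SA u x; have := Sform_ge_NQf SA u x.
  have := Sform_le_Qf SA u y; have := Sform_ge_NQf SA u y.
  by rewrite -/K SformDr SformNr ler_norml; lra.
- have iQ := L2vec_rint_qf K hY.
  apply: rintD; apply: rintZ; apply: rintD; try exact: rint_cst; last exact: rint_Knorm.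
  by apply: rintD => //; exact: rint_cst.
Qed.

(** The case of the inward field alone: integrability of [kap] and coercivity bound the K-norm of X
    by that of Y plus 1 minus [kap]. *)
Let base : [/\ {ae P, forall w, PG S G (Y w) !=set0}, rint P kap & rint P (fun w => Knorm A (X w))].
Proof.
have [||||||ne iL _] := @test_inequality (fun=> 0) 0 0 1 0; rewrite ?ltr01 //.
- exact: cst_continuous.
- by move=> x; rewrite normr0.
have ik : rint P kap.
  by move: iL; congr (rint P _); apply/funext => w; rewrite mul0r add0r mul1r.
split => //.
apply: (@rint_le _ _ _ _ _ (fun w => Knorm A (Y w) + 1 - kap w)).
- apply: (@measurableT_comp _ _ _ _ (Rd R d) _ (Knorm A)); last exact: (PGmap_comp_measurable SA hY hG).
  by apply: continuous_measurable_real; exact: Knorm_continuous.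
- move=> w; rewrite ger0_norm ?Knorm_ge0 //.
  by have := inward_field_coercive (X w) (Y w); rewrite /kap; lra.
- by apply: rintB => //; apply: rintD; [exact: rint_Knorm|exact: rint_cst].
Qed.

Lemma PG_nonempty_ae : {ae P, forall w, PG S G (Y w) !=set0}.
Proof. by have [] := base. Qed.

Lemma PGmap_rint i : rint P (fun w => X w 0 i).
Proof.
have [_ _ iN] := base; have [C C0 hC] := norm_le_Knorm SA.
apply: (@rint_le _ _ _ _ _ (fun w => C * Knorm A (X w))); last exact: rintZ.
- by apply: measurable_coord; exact: (PGmap_comp_measurable SA hY hG).
- by move=> w; apply: le_trans (coord_le_norm _ _) (hC _).
Qed.

(* First-order optimality of G, tested against k = eta v +- (a vanishing inward field). *)
Lemma first_order_condition (eta : 'rV[R]_d -> R) (B r : R) i : continuous eta ->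
  (forall x, `|eta x| <= B) -> (forall x, r < Knorm A x -> eta x = 0) ->
  \int[P]_w (eta (X w) * (Y w 0 i - X w 0 i)) = 0.
Proof.
move=> ceta etaB etar; have [_ ik _] := base.
have iE : rint P (fun w => eta (X w) * (Y w 0 i - X w 0 i)).
  apply: (@rint_le _ _ _ _ _ (fun w => B * `|Y w 0 i - X w 0 i|)).
  - have mX := PGmap_comp_measurable SA hY hG.
    apply: measurable_funM.
      by apply: (@measurableT_comp _ _ _ _ (Rd R d) _ eta) => //; exact: continuous_measurable_real.
    by apply: measurable_funB; apply: measurable_coord => //; exact: hY.1.
  - by move=> w; rewrite normrM ler_wpM2r.
  - by apply: rintZ; apply: rint_abs; apply: rintB; [exact: L2vec_rint|exact: PGmap_rint].
have ge0 (s : R) : s ^+ 2 = 1 -> 0 <= s * \int[P]_w (eta (X w) * (Y w 0 i - X w 0 i)).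
  move=> s2; set I := \int[P]_w _; rewrite leNgt; apply/negP => sI.
  have B0 : 0 <= B by exact: (le_trans (normr_ge0 _) (etaB 0)).
  have h del : 0 < del -> 0 <= s * I + del * \int[P]_w kap w.
    move=> del0; have [||||||_ iL] := @test_inequality (fun x => s * eta x) B (Num.max r 0) del (v i) => //.
    - suff ck (x : 'rV[R]_d) : {for x, continuous (fun x => s * eta x)} by move=> x; exact: ck.
      by apply: (@continuousM _ _ (fun=> s) eta); [exact: cst_continuous|exact: ceta].
    - by rewrite le_max lexx orbT.
    - move=> x; have s1 : `|s| = 1.
        by apply/eqP; rewrite -sqrp_eq1 // real_normK ?num_real // s2.
      by rewrite normrM s1 mul1r.
    - by move=> x; rewrite gt_max => /andP[rx _]; rewrite etar // mulr0.
    have -> : (fun w => s * eta (X w) * Sform S (v i) (Y w - X w) + del * kap w) =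
       (fun w => s * (eta (X w) * (Y w 0 i - X w 0 i)) + del * kap w).
      by apply/funext => w; rewrite Sform_dual_basis !mxE mulrA.
    by rewrite RintegralD // ?RintegralZl //; exact: rintZ.
  have [k0|k0] := leP (\int[P]_w kap w) 0.
    by have := h 1 ltr01; rewrite mul1r; lra.
  (* With this factor the inward term compensates only half of the negative [s * I], a
     contradiction. *)
  have := h (- (s * I) / (2 * \int[P]_w kap w)); rewrite divr_gt0 ?oppr_gt0 ?mulr_gt0 // => /(_ isT).
  have -> : - (s * I) / (2 * \int[P]_w kap w) * \int[P]_w kap w = - (s * I) / 2.
    by field; rewrite gt_eqF.
  lra.
have := ge0 1; have := ge0 (-1); rewrite mul1r mulN1r sqrrN expr1n => /(_ erefl) + /(_ erefl).
by lra.
Qed.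

End TestFields.

(** * The martingale property and square integrability of P_G(Y) *)

Section FirstOrderConsequences.
Variables (R : realType) (d : nat) (S A : 'M[R]_d) (e : 'rV[R]_d).
Hypothesis SA : sign_congruence S A e.
Context (dO : measure_display) (O : measurableType dO) (P : probability O R).
Variables (Y : O -> 'rV[R]_d) (G : set 'rV[R]_d).
Hypotheses (hY : L2vec P Y) (hG : dual_optimal P S Y G).
Hypothesis hSigma : (law P Y).-negligible (SigmaP S G : set (Rd R d)).
Let X w := PGmap S G (Y w).
Let mX : @measurable_fun _ _ O (Rd R d) setT X := PGmap_comp_measurable SA hY hG.
Let Z i w := Y w 0 i - X w 0 i.

Let iZ i : rint P (Z i).
Proof. by apply: rintB; [exact: L2vec_rint|exact: (PGmap_rint SA hY hG hSigma)]. Qed.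

Let clip (a : R) := Num.min 1 (Num.max a 0).

Let clip01 a : 0 <= clip a <= 1.
Proof. by rewrite le_min ler01 le_max lexx orbT ge_min lexx. Qed.

Let clip_le0 a : a <= 0 -> clip a = 0.
Proof. by move=> a0; rewrite /clip (max_r a0) min_r // ler01. Qed.

Let clip_ge1 a : 1 <= a -> clip a = 1.
Proof. by move=> a1; rewrite /clip min_l // le_max a1. Qed.

Let clip_continuous (f : 'rV[R]_d -> R) (x : 'rV[R]_d) :
  {for x, continuous f} -> {for x, continuous (fun x => clip (f x))}.
Proof.
move=> cf; apply: (@continuous_min _ _ (fun=> 1)); first exact: cst_continuous.
by apply: continuous_max => //; exact: cst_continuous.
Qed.

(** For open U these are continuous functions of bounded support that tend to the indicator of U. *)
Let eta (U : set 'rV[R]_d) (n : nat) x := clip (n%:R * codist U x) * clip (n%:R - Knorm A x).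

Let eta01 U n x : 0 <= eta U n x <= 1.
Proof.
have /andP[a0 a1] := clip01 (n%:R * codist U x); have /andP[b0 b1] := clip01 (n%:R - Knorm A x).
by rewrite /eta mulr_ge0 //= mulr_ile1.
Qed.

Let eta_continuous U n : open U -> continuous (eta U n).
Proof.
move=> oU; suff c (x : 'rV[R]_d) : {for x, continuous (eta U n)} by move=> x; exact: c.
apply: (@continuousM _ _ (fun x => clip (n%:R * codist U x)) (fun x => clip (n%:R - Knorm A x))).
  apply: clip_continuous.
  by apply: (@continuousM _ _ (fun=> n%:R) (codist U)); [exact: cst_continuous|exact: codist_continuous].
apply: clip_continuous.
by apply: continuousB; [exact: cst_continuous|exact: Knorm_continuous].
Qed.

Let eta_cvg U x : open U -> eta U n x @[n --> \oo] --> (\1_U x : R).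
Proof.
move=> oU; apply: cvg_near_cst; have [Ux|nUx] := pselect (U x); last first.
  by apply: nearW => n; rewrite /eta codist_out // mulr0 clip_le0 // mul0r indicE memNset.
have c0 := codist_in oU Ux.
exists (Num.truncn ((codist U x)^-1 + Knorm A x + 1)).+1 => // n /= hn.
have hn' : (codist U x)^-1 + Knorm A x + 1 <= n%:R.
  by apply: ltW; apply: lt_le_trans (truncnS_gt _) _; rewrite ler_nat.
have N0 := Knorm_ge0 A x; have ci0 : 0 < (codist U x)^-1 by rewrite invr_gt0.
rewrite /eta indicE mem_set // !clip_ge1 ?mulr1 //; first by lra.
by rewrite -ler_pdivrMr // mul1r; lra.
Qed.

Let open_integral0 U i : open U -> (\int[P]_(w in X @^-1` U) (Z i w)%:E = 0)%E.
Proof.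
move=> oU; have mU := open_measurable_row oU.
have mXU : measurable (X @^-1` U) by rewrite -[X in measurable X]setTI; exact: mX.
have mZ := rint_measurable (iZ i).
have meta n : measurable_fun setT (fun w => eta U n (X w)).
  apply: (@measurableT_comp _ _ _ _ (Rd R d) _ (eta U n)) => //.
  by apply: continuous_measurable_real; exact: eta_continuous.
have inE0 w : (\1_U (X w) : R) = \1_(X @^-1` U) w.
  by rewrite !indicE; congr (_%:R); apply/idP/idP => /set_mem h; exact: mem_set.
have [] := @dominated_convergence _ O R P setT measurableT
  (fun n w => (eta U n (X w) * Z i w)%:E) (fun w => (\1_U (X w) * Z i w)%:E) (fun w => `|Z i w|%:E).
- by move=> n; apply/measurable_EFinP; exact: measurable_funM.
- apply/measurable_EFinP; apply: measurable_funM => //.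
  by under eq_fun do rewrite inE0; exact: measurable_indic.
- apply: aeW => w _; apply: cvg_EFin; first exact: nearW.
  by apply: cvgM; [exact: eta_cvg|exact: cvg_cst].
- exact: (rint_abs (iZ i)).
- apply: aeW => w n _ /=; rewrite lee_fin normrM.
  by have /andP[h0 h1] := eta01 U n (X w); rewrite ger0_norm // ler_piMl.
move=> _ _; have -> : [sequence (\int[P]_w (eta U n (X w) * Z i w)%:E)%E]_n = (fun=> 0%E).
  apply/funext => n /=.
  have ie : rint P (fun w => eta U n (X w) * Z i w).
    apply: (@rint_le _ _ _ _ _ (fun w => `|Z i w|)); last exact: rint_abs.
      exact: measurable_funM.
    by move=> w; have /andP[h0 h1] := eta01 U n (X w); rewrite normrM ger0_norm // ler_piMl.
  rewrite -[LHS]fineK; last by apply: integrable_fin_num => //; exact: ie.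
  congr EFin; apply: (@first_order_condition _ _ _ _ _ SA _ _ _ _ _ hY hG hSigma (eta U n) 1 n%:R).
  - exact: eta_continuous.
  - by move=> x; have /andP[h0 h1] := eta01 U n x; rewrite ger0_norm.
  - by move=> x nx; rewrite /eta [clip (n%:R - _)]clip_le0 ?mulr0 // subr_le0 ltW.
move=> /cvg_lim; rewrite lim_cst // => E.
rewrite integral_mkcond E //; apply: eq_integral => w _; rewrite inE0 patchE indicE.
by case: (_ \in _); rewrite ?mul1r ?mul0r.
Qed.

(** Open sets are closed under intersection and generate the Borel sets, and the sets B with
    vanishing integral form a Dynkin class. *)
Let cond_integral_diff0 B i : measurable (B : set (Rd R d)) ->
  (\int[P]_(w in X @^-1` B) (Z i w)%:E = 0)%E.
Proof.
have mpre F : measurable (F : set (Rd R d)) -> measurable (X @^-1` F).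
  by move=> mF; rewrite -[X in measurable X]setTI; exact: mX.
move=> mB; pattern B; apply: (@dynkin_induction _ (Rd R d) (@open 'rV[R]_d)) => //.
- by move=> U V; exact: openI.
- by apply: open_integral0; exact: openT.
- by move=> U oU; exact: open_integral0.
- move=> F mF F0; have T0 := open_integral0 i (@openT _).
  move: T0; rewrite preimage_setT -(setUv (X @^-1` F)) integral_setU //; first last.
  + by apply/disj_setPS => w [].
  + by rewrite setUv; apply/measurable_EFinP; exact: (rint_measurable (iZ i)).
  + by apply: measurableC; exact: mpre.
  + exact: mpre.
  by rewrite F0 add0e.
- move=> F mF tF F0; rewrite preimage_bigcup integral_bigcup //.
  + by rewrite eseries0 // => n _ _; exact: F0.
  + apply/trivIsetP => a b _ _ ab; rewrite -preimage_setI.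
    by move/trivIsetP : tF => /(_ a b I I ab) ->; rewrite preimage_set0.
  + by move=> n; exact: mpre.
  + apply: integrableS (iZ i) => //; apply: bigcup_measurable => n _; exact: mpre.
Qed.

(** X has only a first moment so far, so its coordinate is truncated to f_n(X). Testing with f_n
    gives E[f_n(X)^2] = E[f_n(X) Y_i], hence E[f_n(X)^2] <= E[Y_i^2], and Fatou's lemma removes the
    truncation. *)
Let rint_sqr i : rint P (fun w => X w 0 i ^+ 2).
Proof.
have mXi : measurable_fun setT (fun w => X w 0 i) by exact: measurable_coord.
pose f (n : nat) (x : Rd R d) : R := (x : 'rV[R]_d) 0 i * \1_[set x : Rd R d | `|(x : 'rV[R]_d) 0 i| <= n%:R] x.
have mset n : measurable [set x : Rd R d | `|(x : 'rV[R]_d) 0 i| <= n%:R].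
  apply: closed_measurable_row; apply: closed_le_fun => x.
  exact: (continuous_comp (@coord_continuous _ _ _ 0 i x) (@norm_continuous _ _ _)).
have mf n : measurable_fun setT (f n).
  apply: measurable_funM; last exact: measurable_indic.
  by apply: continuous_measurable_real => x; exact: coord_continuous.
have fb n x : `|f n x| <= n%:R.
  rewrite /f indicE; have [h|h] := boolP (x \in _); last by rewrite mulr0 normr0.
  by rewrite mulr1; exact: (set_mem h).
have fsq n w : f n (X w) * X w 0 i = f n (X w) ^+ 2.
  by rewrite /f indicE; case: (_ \in _); rewrite ?mulr1 ?mulr0 ?mul0r ?expr2 ?mulr0.
have mfX n : measurable_fun setT (fun w => f n (X w)) by apply: (@measurableT_comp _ _ _ _ (Rd R d) _ (f n)).
have bnd (h : O -> R) n : rint P h -> rint P (fun w => f n (X w) * h w).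
  move=> ih; apply: (@rint_le _ _ _ _ _ (fun w => n%:R * `|h w|)).
  - by apply: measurable_funM => //; exact: (rint_measurable ih).
  - by move=> w; rewrite normrM ler_wpM2r.
  - by apply: rintZ; exact: rint_abs.
have iX := PGmap_rint SA hY hG hSigma i; have iY := L2vec_rint i hY.
have iY2 : rint P (fun w => Y w 0 i ^+ 2) by exact: hY.2.
have if2 n : rint P (fun w => f n (X w) ^+ 2).
  by under eq_fun do rewrite -fsq; exact: bnd.
have le n : \int[P]_w (f n (X w) ^+ 2) <= \int[P]_w (Y w 0 i ^+ 2).
  have : \int[P]_w (f n (X w) * Z i w) = 0.
    apply: (cond_integral0 mX) => //; last exact: bnd.
    by move=> B mB; exact: cond_integral_diff0.
  under eq_Rintegral do rewrite mulrBr fsq.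
  rewrite RintegralB //; [|exact: bnd|exact: if2] => E.
  have : \int[P]_w (f n (X w) * Y w 0 i) <= \int[P]_w (2^-1 * f n (X w) ^+ 2 + 2^-1 * Y w 0 i ^+ 2).
    apply: le_Rintegral => //; [exact: bnd|by apply: rintD; exact: rintZ|].
    by move=> w _; have := sqr_ge0 (f n (X w) - Y w 0 i); rewrite sqrrB; lra.
  rewrite RintegralD //; [|exact: rintZ|exact: rintZ].
  by rewrite !RintegralZl //; [lra|exact: if2].
apply/integrableP; split; first by apply/measurable_EFinP; exact: measurable_funX.
apply: le_lt_trans (_ : ((\int[P]_w (Y w 0 i ^+ 2))%:E < +oo)%E); last by rewrite ltey.
under eq_integral do rewrite /= ger0_norm ?sqr_ge0 //.
apply: (@fatou_le _ _ _ P (fun n w => f n (X w) ^+ 2)).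
- by move=> n; exact: measurable_funX.
- by move=> n w; exact: sqr_ge0.
- by apply/measurable_EFinP; exact: measurable_funX.
- by move=> w; rewrite lee_fin sqr_ge0.
- apply: aeW => w r; rewrite lte_fin => rX; exists (Num.truncn `|X w 0 i|).+1 => n hn.
  rewrite /f indicE mem_set ?mulr1 1?ltW //=.
  by apply: ltW; apply: lt_le_trans (truncnS_gt _) _; rewrite ler_nat.
- move=> n; rewrite -[leLHS]fineK; last by apply: integrable_fin_num => //; exact: if2.
  by rewrite lee_fin; exact: le.
Qed.

Lemma PGmap_L2vec : L2vec P X.
Proof. by apply: L2vec_intro => // i; exact: rint_sqr. Qed.

Lemma PGmap_condexp_id : condexp_id P X Y.
Proof.
move=> B mB i; have mXB : measurable (X @^-1` B).
  by rewrite -[X in measurable X]setTI; exact: mX.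
have iX : P.-integrable (X @^-1` B) (fun w => (X w 0 i)%:E).
  by apply: integrableS (L2vec_rint i PGmap_L2vec).
have iY : P.-integrable (X @^-1` B) (fun w => (Y w 0 i)%:E).
  by apply: integrableS (L2vec_rint i hY).
have := cond_integral_diff0 i mB.
rewrite /Z (_ : (fun _ => _) = (fun w => (Y w 0 i)%:E - (X w 0 i)%:E)%E); last by [].
rewrite integralB //.
have fX := integrable_fin_num mXB iX; have fY := integrable_fin_num mXB iY.
by rewrite -(fineK fX) -(fineK fY) => -[] /eqP; rewrite subr_eq0 => /eqP ->.
Qed.

End FirstOrderConsequences.

(** * Optimality and uniqueness *)

Section Transfer.
Variables (R : realType) (d : nat).

Lemma joint_law_exists (dO : measure_display) (O : measurableType dO) (P : probability O R)
  (X Y : O -> 'rV[R]_d) :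
  @measurable_fun _ _ O (Rd R d) setT X -> @measurable_fun _ _ O (Rd R d) setT Y ->
  exists g0 : probability (Rd R d * Rd R d)%type R, [/\
    (forall A : set (Rd R d * Rd R d)%type, measurable A ->
       g0 A = P ((fun w => ((X w : Rd R d), (Y w : Rd R d))) @^-1` A)),
    (forall f : Rd R d * Rd R d -> \bar R, measurable_fun setT f ->
       (\int[g0]_z f z = \int[P]_w f (X w : Rd R d, Y w : Rd R d))%E) &
    (L2vec P X -> L2vec P Y -> condexp_id P X Y -> in_Gamma P Y g0)].
Proof.
move=> mX mY; pose XY w : Rd R d * Rd R d := ((X w : Rd R d), (Y w : Rd R d)).
have mXY : measurable_fun setT XY by exact: measurable_fun_pair.
pose mp := isMeasurableFun.Build _ _ _ _ XY mXY.
pose XYm : {mfun O >-> (Rd R d * Rd R d)%type} := HB.pack XY mp.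
exists (distribution P XYm); split => // [f mf|hX hY cXY].
  exact: (measurable_integral_pushforward P mXY).
split.
- move=> i; split.
  + have m1 : measurable_fun setT (fun z : Rd R d * Rd R d => (((z.1 : 'rV[R]_d) 0 i) ^+ 2)%:E).
      apply/measurable_EFinP; apply: measurable_funX.
      by apply: (@measurable_coord _ _ R d (fun z : Rd R d * Rd R d => z.1)); exact: measurable_fst.
    by apply: integrable_pushforward => //; exact: hX.2.
  + have m1 : measurable_fun setT (fun z : Rd R d * Rd R d => (((z.2 : 'rV[R]_d) 0 i) ^+ 2)%:E).
      apply/measurable_EFinP; apply: measurable_funX.
      by apply: (@measurable_coord _ _ R d (fun z : Rd R d * Rd R d => z.2)); exact: measurable_snd.
    by apply: integrable_pushforward => //; exact: hY.2.
- by [].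
- move=> B mB i.
  have m1 : measurable_fun setT (fun z : Rd R d * Rd R d => ((z.1 : 'rV[R]_d) 0 i)%:E).
    apply/measurable_EFinP.
    by apply: (@measurable_coord _ _ R d (fun z : Rd R d * Rd R d => z.1)); exact: measurable_fst.
  have m2 : measurable_fun setT (fun z : Rd R d * Rd R d => ((z.2 : 'rV[R]_d) 0 i)%:E).
    apply/measurable_EFinP.
    by apply: (@measurable_coord _ _ R d (fun z : Rd R d * Rd R d => z.2)); exact: measurable_snd.
  have mB1 : measurable (fst @^-1` B : set (Rd R d * Rd R d)%type).
    by rewrite -[X in measurable X]setTI; exact: measurable_fst.
  have mXB : measurable (X @^-1` B) by rewrite -[X in measurable X]setTI; exact: mX.
  rewrite !integral_pushforward //; first exact: cXY.
  + by apply: integrableS (L2vec_rint i hX).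
  + by apply: integrableS (L2vec_rint i hY).
Qed.

(** Under a plan the two projections are random vectors forming a martingale coupling, so one
    argument covers maps and plans. *)
Lemma in_Gamma_vectors (dO : measure_display) (O : measurableType dO) (P : probability O R)
  (Y : O -> 'rV[R]_d) (g : probability (Rd R d * Rd R d)%type R) : in_Gamma P Y g ->
  [/\ L2vec g (fun z : Rd R d * Rd R d => z.1 : 'rV[R]_d),
      L2vec g (fun z : Rd R d * Rd R d => z.2 : 'rV[R]_d) &
      condexp_id g (fun z : Rd R d * Rd R d => z.1 : 'rV[R]_d) (fun z => z.2 : 'rV[R]_d)].
Proof.
move=> [h1 _ h3]; split; [split|split|].
- exact: measurable_fst.
- by move=> i; exact: (h1 i).1.
- exact: measurable_snd.
- by move=> i; exact: (h1 i).2.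
- exact: h3.
Qed.

End Transfer.

Section Optimality.
Variables (R : realType) (d : nat) (S A : 'M[R]_d) (e : 'rV[R]_d).
Hypothesis SA : sign_congruence S A e.
Context (dO : measure_display) (O : measurableType dO) (P : probability O R).
Variables (Y : O -> 'rV[R]_d) (G : set 'rV[R]_d).
Hypotheses (hY : L2vec P Y) (hG : dual_optimal P S Y G).
Hypothesis hSigma : (law P Y).-negligible (SigmaP S G : set (Rd R d)).
Let X w := PGmap S G (Y w).
Let hX : L2vec P X := PGmap_L2vec SA hY hG hSigma.
Let cX : condexp_id P X Y := PGmap_condexp_id SA hY hG hSigma.

(** There is no duality gap: almost surely psi_G(Y) = S(X, Y) - q(X), and E[S(X, Y)] = 2 E[q(X)]. *)
Lemma PGmap_value : ((\int[P]_w qf S (X w))%:E = \int[P]_w psi S G (Y w))%E.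
Proof.
have iXY := L2vec_rint_Sform S hX hY; have iq := L2vec_rint_qf S hX.
have -> : (\int[P]_w psi S G (Y w) = \int[P]_w (Sform S (X w) (Y w) - qf S (X w))%:E)%E.
  apply: ae_eq_integral => //.
  - exact: (measurable_psi_comp _ hY).
  - by apply/measurable_EFinP; exact: (rint_measurable (rintB iXY iq)).
  apply: filterS2 (PG_nonempty_ae SA hY hG hSigma) (law_negligible_ae hY.1 hSigma) => w n0 nS _.
  have : PG S G (Y w) (X w) by rewrite (PGmap_mem nS n0).
  by move=> /PGP[].
have iphi := rintB iXY iq.
rewrite -[RHS]fineK; last by apply: integrable_fin_num => //; exact: iphi.
congr EFin; rewrite -[RHS]/(\int[P]_w (Sform S (X w) (Y w) - qf S (X w))) RintegralB //.
have := condexp_id_value S hX hY cX.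
rewrite -[X in (_ * X)%E]fineK; last by apply: integrable_fin_num => //; exact: iXY.
by rewrite -EFinM -/(\int[P]_w Sform S (X w) (Y w)) => -[]; lra.
Qed.

Section Coupling.
Context (dT : measure_display) (T : measurableType dT) (mu : probability T R).
Variables X' Y' : T -> 'rV[R]_d.
Hypotheses (hX' : L2vec mu X') (hY' : L2vec mu Y') (c' : condexp_id mu X' Y').
Hypothesis lawY' : forall B : set (Rd R d), measurable B -> mu (Y' @^-1` B) = law P Y B.

Let integral_Y' (f : Rd R d -> \bar R) : measurable_fun setT f ->
  (\int[mu]_w f (Y' w) = \int[P]_w f (Y w))%E.
Proof.
move=> mf; rewrite -(integral_law mu hY'.1 mf) -(integral_law P hY.1 mf).
pose Ym : {mfun O >-> Rd R d} := HB.pack Y (isMeasurableFun.Build _ _ O (Rd R d) Y hY.1).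
pose Ym' : {mfun T >-> Rd R d} := HB.pack Y' (isMeasurableFun.Build _ _ T (Rd R d) Y' hY'.1).
apply: (@eq_measure_integral _ _ _ setT (distribution P Ym) (distribution mu Ym')) => B mB _.
exact: lawY'.
Qed.

Let ipsi' : mu.-integrable setT (fun w => psi S G (Y' w)).
Proof.
have := dual_optimal_integrable SA hY hG.
have ma : measurable_fun setT (fun y : Rd R d => `|psi S G y|%E).
  by apply: measurableT_comp => //; exact: psi_measurable.
move=> /integrableP[_ lt]; apply/integrableP; split; first exact: (measurable_psi_comp _ hY').
by rewrite (integral_Y' ma).
Qed.

(** The coupling may live on its own probability space and is tied to Y only through the law of
    [Y']; this admits plans as well as maps. *)
Lemma coupling_value_le : ((2^-1)%:E * \int[mu]_w (Sform S (X' w) (Y' w))%:E <=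
  (2^-1)%:E * \int[P]_w (Sform S (X w) (Y w))%:E)%E.
Proof.
rewrite (condexp_id_value S hX' hY' c') (condexp_id_value S hX hY cX) PGmap_value.
rewrite -(integral_Y' (psi_measurable S G)).
exact: (weak_duality SA hG.1 hX' hY' c' ipsi').
Qed.

(** Equality in weak duality makes X' a maximizer for Y', and the maximizer is unique off [SigmaP],
    which the common law of Y and Y' does not charge. *)
Lemma coupling_value_eq : ((2^-1)%:E * \int[P]_w (Sform S (X w) (Y w))%:E <=
  (2^-1)%:E * \int[mu]_w (Sform S (X' w) (Y' w))%:E)%E ->
  {ae mu, forall w, X' w = PGmap S G (Y' w)}.
Proof.
rewrite (condexp_id_value S hX' hY' c') (condexp_id_value S hX hY cX) PGmap_value.
rewrite -(integral_Y' (psi_measurable S G)) => le.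
have hS' : {ae mu, forall w, ~ SigmaP S G (Y' w)}.
  have [B [mB PB SB]] := hSigma; exists (Y' @^-1` B); split.
  - by rewrite -[X in measurable X]setTI; exact: hY'.1.
  - by rewrite lawY'.
  - by move=> w /= /contrapT /SB.
apply: filterS2 (weak_duality_eq SA hG.1 hX' hY' c' ipsi' le) hS' => w Px nS.
by move: (Px); rewrite (PGmap_mem nS) //; exists (X' w).
Qed.

End Coupling.
End Optimality.

Theorem theorem5 (R : realType) (d m : nat) (S : 'M[R]_d) (hS : in_Sdm m S)
  (dO : measure_display) (O : measurableType dO) (P : probability O R)
  (Y : O -> 'rV[R]_d) (hY : L2vec P Y)
  (G : set 'rV[R]_d) (hG : dual_optimal P S Y G)
  (hSigma : (law P Y).-negligible (SigmaP S G : set (Rd R d))) :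
  let X := fun w => PGmap S G (Y w) in
  (optimal_map P S Y X /\
   forall X', optimal_map P S Y X' -> {ae P, forall w, X' w = X w}) /\
  exists g0 : probability (Rd R d * Rd R d)%type R,
    (forall A : set (Rd R d * Rd R d)%type, measurable A ->
       g0 A = P ((fun w => ((X w : Rd R d), (Y w : Rd R d))) @^-1` A)) /\
    optimal_plan P S Y g0 /\
    (forall g, optimal_plan P S Y g ->
       forall A : set (Rd R d * Rd R d)%type, measurable A -> g A = g0 A).
Proof.
have [symS Su _] := hS.
have [A [e [Au SE e1]]] := symmetric_congruent_sign symS Su.
have SA : sign_congruence S A e by [].
move=> X.
have mX : @measurable_fun _ _ O (Rd R d) setT X := PGmap_comp_measurable SA hY hG.
have hX : L2vec P X := PGmap_L2vec SA hY hG hSigma.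
have cX : condexp_id P X Y := PGmap_condexp_id SA hY hG hSigma.
have mPG : @measurable_fun _ _ (Rd R d) (Rd R d) setT (PGmap S G).
  apply: (PGmap_measurable (max_S_monotone_closed hG.1)) => y.
  by have := max_S_monotone_psi_ge SA hG.1 y; case: (psi S G y).
have XcalX : calX P Y X.
  split => //; exists X; split; last exact: aeW.
  move=> B mB; exists (PGmap S G @^-1` B); split => //.
  by rewrite -[X in measurable X]setTI; exact: mPG.
split.
  split; first split => // X' [hX' _ cX'].
    exact: (coupling_value_le SA hY hG hSigma hX' hY cX').
  move=> X' [[hX' _ cX'] opt].
  exact: (coupling_value_eq SA hY hG hSigma hX' hY cX' _ (opt _ XcalX)).
have [g0 [g0E g0int g0Gamma]] := joint_law_exists P mX hY.1.
have mS : measurable_fun setT (fun z : Rd R d * Rd R d => (Sform S z.1 z.2)%:E).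
  apply/measurable_EFinP.
  have h := @measurable_Sform R d S _ (Rd R d * Rd R d)%type fst snd.
  by apply: h; [exact: measurable_fst|exact: measurable_snd].
have valE : plan_value S g0 = map_value P S X Y.
  by rewrite /plan_value (g0int _ mS).
have Gamma0 : in_Gamma P Y g0 by exact: g0Gamma.
exists g0; split => //; split.
  split => // g' gG'; have [h1 h2 h3] := in_Gamma_vectors gG'; have [_ lawg _] := gG'.
  rewrite valE; exact: (coupling_value_le SA hY hG hSigma h1 h2 h3 lawg).
move=> g [gG opt] B mB; have [h1 h2 h3] := in_Gamma_vectors gG; have [_ lawg _] := gG.
have := opt _ Gamma0; rewrite valE => /(coupling_value_eq SA hY hG hSigma h1 h2 h3 lawg) ae1.
have mgr : @measurable_fun _ _ (Rd R d) (Rd R d * Rd R d)%type setT (fun y => (PGmap S G y, y)).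
  by apply: measurable_fun_pair => //; exact: measurable_id.
(* Both plans are carried by the graph of [PGmap S G], where membership in B depends on y alone.
   Their values at B are therefore the mass that the common second marginal gives to [B']. *)
pose B' := (fun y : Rd R d => (PGmap S G y : Rd R d, y)) @^-1` B.
have mB' : measurable B' by rewrite -[X in measurable X]setTI; exact: mgr.
have -> : g0 B = g (snd @^-1` B') by rewrite (g0E _ mB) (lawg _ mB').
have mB2 : measurable (snd @^-1` B' : set (Rd R d * Rd R d)%type).
  by rewrite -[X in measurable X]setTI; exact: measurable_snd.
have [N [mN gN hN]] := ae1.
have out z : ~ N z -> z.1 = PGmap S G z.2 by move=> nN; apply: contrapT => h; apply: nN; exact: hN.
have cut C : measurable C -> g C = g (C `\` N).
  move=> mC; rewrite [LHS](measureDI g mC mN) -[RHS]adde0; congr (_ + _)%E.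
  apply/eqP; rewrite eq_le measure_ge0 andbT -gN.
  by apply: le_measure; [exact/mem_set/measurableI|exact/mem_set|exact: subIsetr].
rewrite (cut _ mB) (cut _ mB2); congr (g _); apply/seteqP; split => -[x y] [Bz nN]; split => //.
  by rewrite /B' /=; have := out _ nN => /= <-.
by have := out _ nN => /= ->.
Qed.
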